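(* Let $f,g$ be convergent power series in $(x,y)$ starting with terms of order at least two, and let $v$ be the analytic vector field $$\frac{dx}{dt}=y+f(x,y),\qquad \frac{dy}{dt}=g(x,y).$$ Assume that $v$ has a non-singular formal integral. Then $v$ can be transformed, through a convergent transformation, into a system of the form $$\frac{dx}{dt}=y+r(x),\qquad \frac{dy}{dt}=0 ,$$ where $r$ is a power series in $x$ starting with terms of order at least two.
   Context: Power series have coefficients in $\mathbb{K}$, where $\mathbb K=\mathbb R$ or $\mathbb K=\mathbb C$ (the result is understood in both the real analytic and the holomorphic setting, all objects being over the same $\mathbb K$). A transformation is an invertible (formal or convergent) change of coordinates near the origin fixing the origin, given by power series in $(x,y)$; it is convergent if these power series converge near the origin. A transformation $\varphi$ transforms a vector field $v$ into $\tilde v$ if $\tilde v=\varphi_*v$ (identity of formal power series). A non-singular formal integral of $v$ is a formal power series $H(x,y)$ such that $dH(0)\neq 0$ and $\langle v,\nabla H\rangle=(y+f)H_x+gH_y=0$. *)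

(* Defs.v *)
From HB Require Import structures.
From mathcomp Require Import all_boot all_order all_algebra.
From mathcomp Require Import boolp classical_sets functions reals topology.
From mathcomp Require Import normedtype sequences.

Set Implicit Arguments.
Unset Strict Implicit.
Unset Printing Implicit Defensive.

Import Order.TTheory GRing.Theory Num.Theory.
Import numFieldNormedType.Exports.

Local Open Scope ring_scope.

(* [a i j] is the coefficient of x^i y^j. A record, and not a plain function
   type, so that the Cauchy product below cannot be confused with the pointwise
   ring structure that the classical library puts on function types. *)
Record fps2 (K : Type) := FPS2 { coef2 :> nat -> nat -> K }.

HB.instance Definition _ (K : Type) := gen_eqMixin (fps2 K).
HB.instance Definition _ (K : Type) := gen_choiceMixin (fps2 K).

Lemma fps2P (K : Type) (a b : fps2 K) : (forall i j, a i j = b i j) <-> a = b.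
Proof.
split=> [|-> //]; case: a b => [a] [b] /= eab; congr FPS2.
by apply/funext => i; apply/funext => j.
Qed.

Section Ring.
Variable K : comNzRingType.
Implicit Types a b c : fps2 K.

Definition fps2_zero : fps2 K := FPS2 (fun _ _ => 0).
Definition fps2_add a b : fps2 K := FPS2 (fun i j => a i j + b i j).
Definition fps2_opp a : fps2 K := FPS2 (fun i j => - a i j).
Definition fps2_one : fps2 K :=
  FPS2 (fun i j => ((i == 0%N) && (j == 0%N))%:R).
Definition fps2_mul a b : fps2 K := FPS2 (fun i j =>
  \sum_(k < i.+1) \sum_(l < j.+1) a k l * b (i - k)%N (j - l)%N).

Fact fps2_addA : associative fps2_add.
Proof. by move=> a b c; apply/fps2P => i j /=; rewrite addrA. Qed.
Fact fps2_addC : commutative fps2_add.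
Proof. by move=> a b; apply/fps2P => i j /=; rewrite addrC. Qed.
Fact fps2_add0 : left_id fps2_zero fps2_add.
Proof. by move=> a; apply/fps2P => i j /=; rewrite add0r. Qed.
Fact fps2_addN : left_inverse fps2_zero fps2_opp fps2_add.
Proof. by move=> a; apply/fps2P => i j /=; rewrite addNr. Qed.

HB.instance Definition _ := GRing.isZmodule.Build (fps2 K)
  fps2_addA fps2_addC fps2_add0 fps2_addN.

(* The ring axioms are inherited from those of iterated polynomials. *)
Definition fps2_trunc n a : {poly {poly K}} :=
  \poly_(i < n) \poly_(j < n) a i j.

Lemma coef_fps2_trunc n a i j :
  (i < n)%N -> (j < n)%N -> (fps2_trunc n a)`_i`_j = a i j.
Proof. by move=> ltin ltjn; rewrite coef_poly ltin coef_poly ltjn. Qed.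

Lemma coef2_polyM (p q : {poly {poly K}}) i j :
  (p * q)`_i`_j
  = \sum_(k < i.+1) \sum_(l < j.+1) p`_k`_l * q`_(i - k)`_(j - l).
Proof. by rewrite coefM coef_sum; apply: eq_bigr => k _; rewrite coefM. Qed.

Lemma fps2_mul_poly (p q : {poly {poly K}}) n a b i j :
    (forall k l, (k < n)%N -> (l < n)%N -> p`_k`_l = a k l) ->
    (forall k l, (k < n)%N -> (l < n)%N -> q`_k`_l = b k l) ->
    (i < n)%N -> (j < n)%N ->
  (p * q)`_i`_j = fps2_mul a b i j.
Proof.
move=> pa qb ltin ltjn; rewrite coef2_polyM /=.
apply: eq_bigr => k _; apply: eq_bigr => l _; rewrite pa ?qb //.
- exact: leq_ltn_trans (leq_subr _ _) ltin.
- exact: leq_ltn_trans (leq_subr _ _) ltjn.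
- exact: leq_trans (ltn_ord k) ltin.
- exact: leq_trans (ltn_ord l) ltjn.
Qed.

Fact fps2_mulA : associative fps2_mul.
Proof.
move=> a b c; apply/fps2P => i j; pose n := (maxn i j).+1.
have ltin : (i < n)%N by rewrite ltnS leq_maxl.
have ltjn : (j < n)%N by rewrite ltnS leq_maxr.
pose t := fps2_trunc n.
have tE u k l : (k < n)%N -> (l < n)%N -> (t u)`_k`_l = u k l.
  exact: coef_fps2_trunc.
have tM u v k l : (k < n)%N -> (l < n)%N -> (t u * t v)`_k`_l = fps2_mul u v k l.
  by move=> ? ?; apply: (@fps2_mul_poly _ _ n) => // ? ?; apply: tE.
rewrite -(fps2_mul_poly (tE a) (tM b c)) // mulrA.
by rewrite -(fps2_mul_poly (tM a b) (tE c)).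
Qed.

Fact fps2_mulC : commutative fps2_mul.
Proof.
move=> a b; apply/fps2P => i j; pose n := (maxn i j).+1.
have ltin : (i < n)%N by rewrite ltnS leq_maxl.
have ltjn : (j < n)%N by rewrite ltnS leq_maxr.
have tE u k l : (k < n)%N -> (l < n)%N -> (fps2_trunc n u)`_k`_l = u k l.
  exact: coef_fps2_trunc.
by rewrite -(fps2_mul_poly (tE a) (tE b)) // mulrC (fps2_mul_poly (tE b) (tE a)).
Qed.

Fact fps2_mul1 : left_id fps2_one fps2_mul.
Proof.
move=> a; apply/fps2P => i j /=.
rewrite big_ord_recl big_ord_recl /= mul1r !subn0 !big1 ?addr0 //.
- by move=> k _; rewrite big1 // => l _; rewrite mul0r.
- by move=> l _; rewrite mul0r.
Qed.

Fact fps2_mulD : left_distributive fps2_mul fps2_add.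
Proof.
move=> a b c; apply/fps2P => i j /=; rewrite -big_split; apply: eq_bigr => k _.
by rewrite -big_split; apply: eq_bigr => l _; rewrite mulrDl.
Qed.

Fact fps2_one_neq0 : fps2_one != 0 :> fps2 K.
Proof. by apply/eqP => /fps2P /(_ 0%N 0%N) /eqP; rewrite oner_eq0. Qed.

HB.instance Definition _ := GRing.Zmodule_isComNzRing.Build (fps2 K)
  fps2_mulA fps2_mulC fps2_mul1 fps2_mulD fps2_one_neq0.

End Ring.

Section FormalCalculus.
Variable K : comNzRingType.
Implicit Types (a H : fps2 K) (phi psi v w : fps2 K * fps2 K).

Definition fpsX : fps2 K := FPS2 (fun i j => ((i == 1%N) && (j == 0%N))%:R).
Definition fpsY : fps2 K := FPS2 (fun i j => ((i == 0%N) && (j == 1%N))%:R).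

(* The univariate series r(x) regarded as a series in (x, y). *)
Definition fps_in_x (r : nat -> K) : fps2 K :=
  FPS2 (fun i j => if j == 0%N then r i else 0).

Definition order_ge (n : nat) a : Prop :=
  forall i j, (i + j < n)%N -> a i j = 0.

Definition fps_dx a : fps2 K := FPS2 (fun i j => a i.+1 j *+ i.+1).
Definition fps_dy a : fps2 K := FPS2 (fun i j => a i j.+1 *+ j.+1).

(* Substitution a(phi(x, y)), meaningful when phi fixes the origin: then
   phi.1^k phi.2^l has order at least k + l, so that only the terms with
   k + l <= i + j contribute to the coefficient of x^i y^j. *)
Definition fps_comp a phi : fps2 K := FPS2 (fun i j =>
  \sum_(k < (i + j).+1) \sum_(l < (i + j).+1)
    a k l * (phi.1 ^+ k * phi.2 ^+ l) i j).

Definition map_comp phi psi : fps2 K * fps2 K :=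
  (fps_comp phi.1 psi, fps_comp phi.2 psi).

Definition fixes_origin phi : Prop :=
  phi.1 0%N 0%N = 0 /\ phi.2 0%N 0%N = 0.

Definition inverse_transformations phi psi : Prop :=
  [/\ fixes_origin phi, fixes_origin psi,
      map_comp phi psi = (fpsX, fpsY) & map_comp psi phi = (fpsX, fpsY)].

Definition transformation phi : Prop :=
  exists psi, inverse_transformations phi psi.

(* A vector field v.1 d/dx + v.2 d/dy is given by its components; this is
   <v, grad H>. *)
Definition lie_derivative v H : fps2 K := v.1 * fps_dx H + v.2 * fps_dy H.

(* phi_* v = (D phi . v) o psi, where psi is the inverse of phi. *)
Definition pushforward phi psi v : fps2 K * fps2 K :=
  map_comp (lie_derivative v phi.1, lie_derivative v phi.2) psi.

Definition transforms phi v w : Prop :=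
  exists2 psi, inverse_transformations phi psi & pushforward phi psi v = w.

Definition nonsingular_formal_integral v H : Prop :=
  (fps_dx H 0%N 0%N, fps_dy H 0%N 0%N) <> (0, 0) /\ lie_derivative v H = 0.

End FormalCalculus.

Section Convergence.
Variable K : numFieldType.

(* Absolute convergence on a polydisc around the origin, the double series
   being summed by total degree. *)
Definition fps_convergent (a : fps2 K) : Prop :=
  exists2 rho : K, 0 < rho &
    forall x y : K, `|x| < rho -> `|y| < rho ->
      cvgn (series (fun n =>
        \sum_(i < n.+1) `|a i (n - i)%N * x ^+ i * y ^+ (n - i)%N|)).

Definition convergent_transformation (phi : fps2 K * fps2 K) : Prop :=
  [/\ transformation phi, fps_convergent phi.1 & fps_convergent phi.2].

End Convergence.

Arguments fpsX {K}.
Arguments fpsY {K}.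

(* Main.v *)
Require Import Defs.
From mathcomp Require Import all_boot all_order all_algebra complex reals.
From mathcomp Require Import boolp classical_sets functions topology.
From mathcomp Require Import normedtype sequences.
From mathcomp Require Import zify ring lra.

Set Implicit Arguments.
Unset Strict Implicit.
Unset Printing Implicit Defensive.

Import Order.TTheory GRing.Theory Num.Theory.
Import numFieldNormedType.Exports.
Local Open Scope ring_scope.

(** Write v = (y + f) d/dx + g d/dy. The integral H forces g to vanish on the smooth
    curve y + f = 0, because H_y is a unit ([divide_by_xdot]). Division of a
    convergent series by a coordinate gives a convergent quotient, so v is a
    convergent function times a convergent nonsingular field. In the coordinates
    (x, y + f) this field has the form d/dx + h d/dy. The formal integral has then served its purpose: the convergent
    flow of d/dx + h d/dy straightens the foliation, and in suitable coordinates v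
    is F(x, y) d/dx with F = y + higher order terms ([straighten_foliation]).

    There remains a family of vector fields on a line, with parameter y. Its zeros
    form a smooth curve y = z(x), and on it the normal form prescribes the coordinate
    X up to a primitive: comparing the derivatives of F and of y + r(X) across the
    curve gives X' = 1 / F_y. With this choice the two time forms dx / F and
    dX / (y + r(X)) have the same polar part on the curve, and their difference can
    be integrated. Concretely X = X0(x + F S), where X0 is that primitive and S solves
    a differential equation in x that has no singularity ([fibre_coordinate]); then
    r = - z o X0^-1 ([normalize_fibrewise]).

    Convergence is treated formally. A series is summable when its coefficients,
    weighted by powers of a small radius, have bounded absolute sums; these sums are
    submultiplicative and behave well under substitution ([norm_le_comp]). Inverse
    maps and solutions of differential equations are fixed points of maps that
    contract for the order of vanishing and preserve a ball for this norm; the ball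
    is closed, so the fixed point is in it ([fps_fixpoint], [tangent_inverse],
    [tame_ode]). Completeness of the field enters only to pass from bounded sums
    back to convergent series. *)

(** * The ring of power series in two variables *)

Section Formal.
Variable K : comNzRingType.
Implicit Types (a b : fps2 K) (phi psi v w : fps2 K * fps2 K).

Lemma fpsD a b i j : (a + b) i j = a i j + b i j. Proof. by []. Qed.
Lemma fpsN a i j : (- a) i j = - a i j. Proof. by []. Qed.
Lemma fpsB a b i j : (a - b) i j = a i j - b i j. Proof. by []. Qed.
Lemma fps0 i j : (0 : fps2 K) i j = 0. Proof. by []. Qed.
Lemma fpsM a b i j : (a * b) i j =
  \sum_(k < i.+1) \sum_(l < j.+1) a k l * b (i - k)%N (j - l)%N.
Proof. by []. Qed.

Lemma fps_sum (I : Type) (r : seq I) (P : pred I) (F : I -> fps2 K) i j :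
  (\sum_(x <- r | P x) F x) i j = \sum_(x <- r | P x) F x i j.
Proof. by elim/big_rec2: _ => // x c d _ <-. Qed.

Definition mon (c : K) (k l : nat) : fps2 K :=
  FPS2 (fun i j => if (i == k) && (j == l) then c else 0).

Lemma fpsXE : fpsX = mon 1 1 0.
Proof. by apply/fps2P => i j /=; case: ifP. Qed.
Lemma fpsYE : fpsY = mon 1 0 1.
Proof. by apply/fps2P => i j /=; case: ifP. Qed.
Lemma fps1E : 1 = mon 1 0 0.
Proof. by apply/fps2P => i j /=; case: ifP. Qed.

Lemma mon_mulE c k l a i j : (mon c k l * a) i j =
  if (k <= i)%N && (l <= j)%N then c * a (i - k)%N (j - l)%N else 0.
Proof.
transitivity (\sum_(k' < i.+1 | k' == k :> nat) \sum_(l' < j.+1 | l' == l :> nat)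
   c * a (i - k')%N (j - l')%N).
  rewrite fpsM [RHS]big_mkcond; apply: eq_bigr => k' _ /=.
  case: eqP => _ /=; last by rewrite big1 // => l' _; rewrite mul0r.
  by rewrite [RHS]big_mkcond; apply: eq_bigr => l' _; case: eqP => // _; rewrite mul0r.
rewrite (big_ord1_eq _ (fun k' => \sum_(l' < j.+1 | l' == l :> nat)
   c * a (i - k')%N (j - l')%N)) ltnS; case: leqP => //= _.
by rewrite (big_ord1_eq _ (fun l' => c * a (i - k)%N (j - l')%N)) ltnS.
Qed.

Lemma monM c k l c' k' l' :
  mon c k l * mon c' k' l' = mon (c * c') (k + k')%N (l + l')%N.
Proof.
apply/fps2P => i j; rewrite mon_mulE /=.
have e m n p : (m <= n)%N && (n - m == p)%N = (n == m + p)%N.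
  apply/andP/eqP => [[le /eqP <-]|->]; first by rewrite subnKC.
  by rewrite leq_addr addKn.
rewrite -(e k) -(e l); do 2 case: leqP => //= _; rewrite ?andbF //.
by case: ifP; rewrite ?mulr0.
Qed.

Lemma mul_fpsX a i j : (fpsX * a) i j = if i is i'.+1 then a i' j else 0.
Proof. by rewrite fpsXE mon_mulE; case: i => //= i; rewrite subSS !subn0 mul1r. Qed.

Lemma mul_fpsY a i j : (fpsY * a) i j = if j is j'.+1 then a i j' else 0.
Proof. by rewrite fpsYE mon_mulE; case: j => //= j; rewrite subSS !subn0 mul1r. Qed.

Lemma order_geW m n a : (n <= m)%N -> order_ge m a -> order_ge n a.
Proof. by move=> le H i j lt; apply: H; apply: leq_trans le. Qed.
Lemma order_ge0 a : order_ge 0 a. Proof. by []. Qed.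
Lemma order_geD n a b : order_ge n a -> order_ge n b -> order_ge n (a + b).
Proof. by move=> A B i j lt; rewrite fpsD A // B // addr0. Qed.
Lemma order_geN n a : order_ge n a -> order_ge n (- a).
Proof. by move=> A i j lt; rewrite fpsN A // oppr0. Qed.
Lemma order_geM m n a b : order_ge m a -> order_ge n b -> order_ge (m + n) (a * b).
Proof.
move=> A B i j lt; rewrite fpsM big1 // => k _; rewrite big1 // => l _.
have [ltm|lem] := ltnP (k + l) m; first by rewrite A ?mul0r.
rewrite B ?mulr0 //.
by have := ltn_ord k; have := ltn_ord l; lia.
Qed.

End Formal.

(** * Substitution and the chain rule *)

Section Composition.
Variable K : comNzRingType.
Implicit Types (a b : fps2 K) (phi psi v w : fps2 K * fps2 K).

Lemma order_geX n a m : order_ge m a -> order_ge (m * n) (a ^+ n).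
Proof.
move=> A; elim: n => [|n IH]; first by rewrite muln0.
by rewrite exprS mulnS; apply: order_geM.
Qed.

Lemma order_ge1 a : order_ge 1 a <-> a 0%N 0%N = 0.
Proof.
split=> [|a0 i j]; first exact.
by rewrite ltnS leqn0 addn_eq0 => /andP[/eqP -> /eqP ->].
Qed.

(** Polynomials are dense for the order topology, so additive maps that lose at
    most one order are determined by their values on monomials. Every identity
    of substitution and differentiation below is reduced to monomials this way. *)
Lemma eq_on_mon (P Q : fps2 K -> fps2 K) :
    {morph P : a b / a + b} -> {morph Q : a b / a + b} ->
    (forall n a, order_ge n.+1 a -> order_ge n (P a)) ->
    (forall n a, order_ge n.+1 a -> order_ge n (Q a)) ->
    (forall c k l, P (mon c k l) = Q (mon c k l)) ->
  P =1 Q.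
Proof.
move=> PD QD Pc Qc PQ a; apply/fps2P => i j.
pose n := (i + j).+2.
pose t : fps2 K := \sum_(k < n) \sum_(l < n) mon (a k l) k l.
have tE k l : (k < n)%N -> (l < n)%N -> t k l = a k l.
  move=> kn ln; rewrite /t fps_sum (bigD1 (Ordinal kn)) //= [X in _ + X]big1 ?addr0;
    last first.
    move=> k' /eqP ne; rewrite fps_sum big1 // => l' _ /=; case: eqP => //= e.
    by case: ne; apply: val_inj.
  rewrite fps_sum (bigD1 (Ordinal ln)) //= !eqxx [X in _ + X]big1 ?addr0 //.
  move=> l' /eqP ne /=; case: (l =P l') => [e|_]; last by [].
  by case: ne; apply: val_inj.
have rest : order_ge n (a - t).
  by move=> k l lt; rewrite fpsB tE ?subrr //; lia.
have M0 (F : fps2 K -> fps2 K) : {morph F : a b / a + b} -> F 0 = 0.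
  by move=> FD; apply: (addrI (F 0)); rewrite -FD !addr0.
have -> : a = t + (a - t) by rewrite addrC subrK.
rewrite PD QD !fpsD (Pc _ _ rest) ?(Qc _ _ rest) // !addr0.
rewrite !(big_morph _ PD (M0 P PD)) !(big_morph _ QD (M0 Q QD)).
congr (coef2 _ i j); apply: eq_bigr => k _.
rewrite !(big_morph _ PD (M0 P PD)) !(big_morph _ QD (M0 Q QD)).
exact: eq_bigr.
Qed.

Definition tangent_to_id phi :=
  order_ge 2 (phi.1 - fpsX) /\ order_ge 2 (phi.2 - fpsY).

Lemma fixesP psi : fixes_origin psi <-> order_ge 1 psi.1 /\ order_ge 1 psi.2.
Proof. by rewrite /fixes_origin -!order_ge1. Qed.

Lemma order_ge_monomial psi k l :
  fixes_origin psi -> order_ge (k + l) (psi.1 ^+ k * psi.2 ^+ l).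
Proof.
move=> /fixesP[/(order_geX (n:=k)) P1 /(order_geX (n:=l)) P2].
by rewrite -[k in (k + l)%N]mul1n -[l in (_ + l)%N]mul1n; apply: order_geM.
Qed.

Lemma fps_compE a psi i j : fps_comp a psi i j =
  \sum_(k < (i + j).+1) \sum_(l < (i + j).+1)
    a k l * (psi.1 ^+ k * psi.2 ^+ l) i j.
Proof. by []. Qed.

(** Since psi.1 ^+ k * psi.2 ^+ l has order at least k + l, the truncation in the
    definition of substitution may be replaced by any larger one; sums at
    different coefficients then get a common range. *)
Lemma fps_comp_coefE N a psi i j : fixes_origin psi -> (i + j < N)%N ->
  fps_comp a psi i j =
  \sum_(k < N) \sum_(l < N) a k l * (psi.1 ^+ k * psi.2 ^+ l) i j.
Proof.
move=> fx; have z k l : (i + j < k + l)%N -> a k l * (psi.1 ^+ k * psi.2 ^+ l) i j = 0.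
  by move=> lt; rewrite (order_ge_monomial fx lt) mulr0.
move=> ltN; rewrite fps_compE.
rewrite (big_ord_widen N (fun k => \sum_(l < (i + j).+1) a k l *
  (psi.1 ^+ k * psi.2 ^+ l) i j)) // big_mkcond; apply: eq_bigr => k _.
case: ifP => [_|ltk]; last by rewrite big1 // => l _; apply: z; lia.
rewrite (big_ord_widen N (fun l => a k l * (psi.1 ^+ k * psi.2 ^+ l) i j)) //.
rewrite big_mkcond; apply: eq_bigr => l _; case: ifP => // ltl.
by rewrite z //; lia.
Qed.

Lemma fps_compD psi : {morph (fun a => fps_comp a psi) : a b / a + b}.
Proof.
move=> a b; apply/fps2P => i j; rewrite fpsD !fps_compE -big_split; apply: eq_bigr => k _.
by rewrite -big_split; apply: eq_bigr => l _; rewrite mulrDl.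
Qed.

Lemma fps_compN psi : {morph (fun a => fps_comp a psi) : a / - a}.
Proof.
move=> a; apply/fps2P => i j; rewrite fpsN !fps_compE -sumrN; apply: eq_bigr => k _.
by rewrite -sumrN; apply: eq_bigr => l _; rewrite mulNr.
Qed.

Lemma fps_compB psi : {morph (fun a => fps_comp a psi) : a b / a - b}.
Proof. by move=> a b /=; rewrite fps_compD fps_compN. Qed.

Lemma fps_comp0 psi : fps_comp 0 psi = 0.
Proof. by rewrite -[X in fps_comp X](subrr 0) fps_compB subrr. Qed.

Lemma fps_comp_order n a psi :
  fixes_origin psi -> order_ge n a -> order_ge n (fps_comp a psi).
Proof.
move=> fx A i j lt; rewrite fps_compE big1 // => k _; rewrite big1 // => l _.
have [ltn|len] := ltnP (k + l) n; first by rewrite A ?mul0r.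
by rewrite (order_ge_monomial fx) ?mulr0 //; lia.
Qed.

Lemma sum_mon (m : nat -> nat -> K) N c k l : (k < N)%N -> (l < N)%N ->
  \sum_(k' < N) \sum_(l' < N) mon c k l k' l' * m k' l' = c * m k l.
Proof.
move=> kN lN.
transitivity (\sum_(k' < N | k' == k :> nat) \sum_(l' < N | l' == l :> nat)
   c * m k' l').
  rewrite [RHS]big_mkcond; apply: eq_bigr => k' _ /=.
  case: eqP => _ /=; last by rewrite big1 // => l' _; rewrite mul0r.
  by rewrite [RHS]big_mkcond; apply: eq_bigr => l' _; case: eqP => // _; rewrite mul0r.
rewrite (big_ord1_eq _ (fun k' => \sum_(l' < N | l' == l :> nat) c * m k' l')) kN.
by rewrite (big_ord1_eq _ (fun l' => c * m k l')) lN.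
Qed.

Lemma fps_comp_mon c k l psi : fixes_origin psi ->
  fps_comp (mon c k l) psi = mon c 0 0 * (psi.1 ^+ k * psi.2 ^+ l).
Proof.
move=> fx; apply/fps2P => i j; rewrite (@fps_comp_coefE (i + j + k + l).+1) //; last lia.
rewrite mon_mulE !subn0 (@sum_mon (fun k l => (psi.1 ^+ k * psi.2 ^+ l) i j)) //; lia.
Qed.

Lemma mon00M (c d : K) : mon (c * d) 0 0 = mon c 0 0 * mon d 0 0.
Proof. by rewrite monM. Qed.

Lemma fps_compM psi : fixes_origin psi -> {morph (fun a => fps_comp a psi) : a b / a * b}.
Proof.
move=> fx a b; move: a.
have cW n a : order_ge n.+1 a -> order_ge n a by apply: order_geW.
apply: (@eq_on_mon (fun a => fps_comp (a * b) psi)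
                   (fun a => fps_comp a psi * fps_comp b psi)).
- by move=> a a'; rewrite mulrDl fps_compD.
- by move=> a a'; rewrite fps_compD mulrDl.
- move=> n a /cW A; apply: fps_comp_order => //; rewrite -[n]addn0.
  exact: order_geM.
- move=> n a /cW A; rewrite -[n]addn0; apply: order_geM => //.
  exact: fps_comp_order.
move=> c k l; move: b.
apply: (@eq_on_mon (fun b => fps_comp (mon c k l * b) psi)
                   (fun b => fps_comp (mon c k l) psi * fps_comp b psi)).
- by move=> a a'; rewrite mulrDr fps_compD.
- by move=> a a'; rewrite fps_compD mulrDr.
- move=> n a /cW A; apply: fps_comp_order => //; rewrite -[n]add0n.
  exact: order_geM.
- move=> n a /cW A; rewrite -[n]add0n; apply: order_geM => //.
  exact: fps_comp_order.
by move=> c' k' l'; rewrite monM !fps_comp_mon // mon00M !exprD; ring.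
Qed.

Lemma fps_compC c psi : fixes_origin psi -> fps_comp (mon c 0 0) psi = mon c 0 0.
Proof. by move=> fx; rewrite fps_comp_mon // !expr0 !mulr1. Qed.

Lemma fps_comp1 psi : fixes_origin psi -> fps_comp 1 psi = 1.
Proof. by move=> fx; rewrite fps1E fps_compC. Qed.

Lemma fps_compX psi : fixes_origin psi -> fps_comp fpsX psi = psi.1.
Proof. by move=> fx; rewrite fpsXE fps_comp_mon // -fps1E !mul1r mulr1 expr1. Qed.

Lemma fps_compY psi : fixes_origin psi -> fps_comp fpsY psi = psi.2.
Proof. by move=> fx; rewrite fpsYE fps_comp_mon // -fps1E !mul1r expr1. Qed.

Lemma fps_compXn psi a n : fixes_origin psi -> fps_comp (a ^+ n) psi = fps_comp a psi ^+ n.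
Proof.
move=> fx; elim: n => [|n IH]; first by rewrite !expr0 fps_comp1.
by rewrite !exprS fps_compM ?IH.
Qed.

Lemma comp_fixes phi psi :
  fixes_origin phi -> fixes_origin psi -> fixes_origin (Defs.map_comp phi psi).
Proof.
by move=> /fixesP[p1 p2] fx; apply/fixesP; split; apply: fps_comp_order.
Qed.

Lemma fps_compA a phi psi : fixes_origin phi -> fixes_origin psi ->
  fps_comp (fps_comp a phi) psi = fps_comp a (Defs.map_comp phi psi).
Proof.
move=> fp fs; have fc := comp_fixes fp fs; move: a.
have cW n a : order_ge n.+1 a -> order_ge n a by apply: order_geW.
apply: (@eq_on_mon (fun a => fps_comp (fps_comp a phi) psi)
  (fun a => fps_comp a (Defs.map_comp phi psi))).
- by move=> a b; rewrite !fps_compD.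
- by move=> a b; rewrite /= !fps_compD.
- by move=> n a /cW A; apply: fps_comp_order => //; apply: fps_comp_order.
- by move=> n a /cW A; apply: fps_comp_order.
move=> c k l; rewrite /= !fps_comp_mon // !fps_compM // fps_compC // !fps_compXn //.
Qed.

Lemma fps_comp_id a : fps_comp a (fpsX, fpsY) = a.
Proof.
have fx : @fixes_origin K (fpsX, fpsY) by [].
move: a; apply: (@eq_on_mon (fun a => fps_comp a (fpsX, fpsY)) id) => //.
- exact: fps_compD.
- by move=> n a A; apply: fps_comp_order => //; apply: order_geW A.
- by move=> n a; apply: order_geW.
move=> c k l; rewrite fps_comp_mon //= fpsXE fpsYE.
have e m : mon 1 1 0 ^+ m = mon (1 : K) m 0.
  by elim: m => [|m IH]; rewrite ?expr0 ?fps1E // exprS IH monM mulr1.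
have e' m : mon 1 0 1 ^+ m = mon (1 : K) 0 m.
  by elim: m => [|m IH]; rewrite ?expr0 ?fps1E // exprS IH monM mulr1.
by rewrite e e' !monM !mulr1 !add0n addn0.
Qed.

Lemma map_fps_compA phi psi chi : fixes_origin psi -> fixes_origin chi ->
  Defs.map_comp (Defs.map_comp phi psi) chi = Defs.map_comp phi (Defs.map_comp psi chi).
Proof. by move=> fp fs; rewrite /Defs.map_comp /= !fps_compA. Qed.

Lemma tangent_fixes phi : tangent_to_id phi -> fixes_origin phi.
Proof.
case=> /(_ 0%N 0%N isT) + /(_ 0%N 0%N isT).
by rewrite !fpsB /= !subr0.
Qed.

(** Substitution is contracting in the inner map when the outer series has no
    linear term: in a product of k + l >= m factors of order 1, replacing one
    factor by another that agrees with it below order n + 1 changes the product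
    only from order n + m on. Formal fixed points are obtained from m = 2, and
    m = 1 says that substitution does not expand. *)
Lemma fps_comp_congr m n a psi psi' :
    fixes_origin psi -> fixes_origin psi' ->
    (forall k l, (0 < k + l < m)%N -> a k l = 0) ->
    order_ge n.+1 (psi.1 - psi'.1) -> order_ge n.+1 (psi.2 - psi'.2) ->
  order_ge (n + m) (fps_comp a psi - fps_comp a psi').
Proof.
move=> fx fx' A d1 d2.
(* D b b' m: both factors have order m and differ only n orders higher. *)
pose D (b b' : fps2 K) m := [/\ order_ge m b, order_ge m b' & order_ge (n + m) (b - b')].
have DM b b' c c' p q : D b b' p -> D c c' q -> D (b * c) (b' * c') (p + q)%N.
  move=> [B B' BB] [C C' CC]; split; try exact: order_geM.
  have -> : b * c - b' * c' = (b - b') * c + b' * (c - c') by ring.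
  apply: order_geD; first by rewrite addnA; apply: order_geM.
  by rewrite addnCA; apply: order_geM.
have DX b b' p q : D b b' p -> D (b ^+ q) (b' ^+ q) (p * q)%N.
  move=> B; elim: q => [|q IH].
    by rewrite !expr0 muln0; split => //; rewrite subrr.
  by rewrite !exprS mulnS; apply: DM.
have [/fixesP[f1 f2] /fixesP[f1' f2']] := (fx, fx').
have D1 : D psi.1 psi'.1 1%N by split=> //; rewrite addn1.
have D2 : D psi.2 psi'.2 1%N by split=> //; rewrite addn1.
move=> i j lt; rewrite fpsB !fps_compE -sumrB big1 // => k _; rewrite -sumrB big1 // => l _.
rewrite -mulrBr.
have [_ _] := DM _ _ _ _ _ _ (DX _ _ _ k D1) (DX _ _ _ l D2).
rewrite !mul1n => /(_ i j) H.
have [lt0|] := posnP (k + l).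
  have [-> ->] : nat_of_ord k = 0%N /\ nat_of_ord l = 0%N by lia.
  by rewrite !expr0 subrr mulr0.
move=> gt0; have [ltm|lem] := ltnP (k + l) m; first by rewrite A ?mul0r // gt0.
by rewrite -fpsB H ?mulr0 //; lia.
Qed.

Lemma dxD : {morph @fps_dx K : a b / a + b}.
Proof. by move=> a b; apply/fps2P => i j /=; rewrite mulrnDl. Qed.
Lemma dyD : {morph @fps_dy K : a b / a + b}.
Proof. by move=> a b; apply/fps2P => i j /=; rewrite mulrnDl. Qed.
Lemma dx_order n a : order_ge n.+1 a -> order_ge n (fps_dx a).
Proof. by move=> A i j lt /=; rewrite A ?mul0rn. Qed.
Lemma dy_order n a : order_ge n.+1 a -> order_ge n (fps_dy a).
Proof. by move=> A i j lt /=; rewrite A ?mul0rn // addnS. Qed.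

Lemma dx_mon (c : K) (k l : nat) : fps_dx (mon c k l) = mon (c *+ k) k.-1 l.
Proof.
apply/fps2P => i j /=; case: k => [|k] /=; first by rewrite mulr0n mul0rn; case: ifP.
rewrite eqSS; case: (i =P k) => [->|_] /=; last by rewrite mul0rn.
by case: ifP; rewrite ?mul0rn.
Qed.

Lemma dy_mon (c : K) (k l : nat) : fps_dy (mon c k l) = mon (c *+ l) k l.-1.
Proof.
apply/fps2P => i j /=; case: l => [|l] /=.
  by rewrite mulr0n !andbF mul0rn; case: ifP.
rewrite eqSS; case: (j =P l) => [->|_]; last by rewrite !andbF mul0rn.
by case: ifP; rewrite ?mul0rn.
Qed.

(** The Leibniz rule is additive in each argument, so monomials suffice. *)
Lemma leibniz_on_mon (P : fps2 K -> fps2 K) :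
  {morph P : a b / a + b} ->
  (forall n a, order_ge n.+1 a -> order_ge n (P a)) ->
  (forall (c : K) k l (c' : K) k' l', P (mon c k l * mon c' k' l') =
     P (mon c k l) * mon c' k' l' + mon c k l * P (mon c' k' l')) ->
  forall a b, P (a * b) = P a * b + a * P b.
Proof.
move=> D Po H a b; move: a.
have cW n a : order_ge n.+1 a -> order_ge n a by apply: order_geW.
apply: (@eq_on_mon (fun a => P (a * b)) (fun a => P a * b + a * P b)).
- by move=> a a'; rewrite mulrDl D.
- by move=> a a'; rewrite D; ring.
- by move=> n a A; apply: Po; rewrite -[n.+1]addn0; apply: order_geM.
- move=> n a A; apply: order_geD; rewrite -[n]addn0; apply: order_geM => //.
    exact: Po.
  exact: cW.
move=> c k l; move: b.
apply: (@eq_on_mon (fun b => P (mon c k l * b))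
  (fun b => P (mon c k l) * b + mon c k l * P b)).
- by move=> a a'; rewrite mulrDr D.
- by move=> a a'; rewrite D; ring.
- by move=> n a A; apply: Po; rewrite -[n.+1]add0n; apply: order_geM.
- move=> n a A; apply: order_geD; rewrite -[n]add0n; apply: order_geM => //.
    exact: cW.
  exact: Po.
exact: H.
Qed.

Lemma monD (c d : K) k l : mon (c + d) k l = mon c k l + mon d k l.
Proof. by apply/fps2P => i j /=; case: ifP; rewrite ?addr0. Qed.

Lemma mon0 k l : mon (0 : K) k l = 0.
Proof. by apply/fps2P => i j /=; case: ifP. Qed.

Lemma dxM a b : fps_dx (a * b) = fps_dx a * b + a * fps_dx b.
Proof.
move: a b; apply: leibniz_on_mon; [exact: dxD|exact: dx_order|].
move=> c k l c' k' l'; rewrite !(monM, dx_mon) mulrnDr monD.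
rewrite -mulrnAl -mulrnAr; congr (_ + _).
  by case: k => [|k] //=; rewrite mulr0n mul0r !mon0.
by case: k' => [|k'] /=; [rewrite mulr0n mulr0 !mon0|rewrite addnS].
Qed.

Lemma dyM a b : fps_dy (a * b) = fps_dy a * b + a * fps_dy b.
Proof.
move: a b; apply: leibniz_on_mon; [exact: dyD|exact: dy_order|].
move=> c k l c' k' l'; rewrite !(monM, dy_mon) mulrnDr monD.
rewrite -mulrnAl -mulrnAr; congr (_ + _).
  by case: l => [|l] //=; rewrite mulr0n mul0r !mon0.
by case: l' => [|l'] /=; [rewrite mulr0n mulr0 !mon0|rewrite addnS].
Qed.

Lemma lieD v : {morph lie_derivative v : a b / a + b}.
Proof. by move=> a b; rewrite /lie_derivative dxD dyD; ring. Qed.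

Lemma lieM v a b :
  lie_derivative v (a * b) = lie_derivative v a * b + a * lie_derivative v b.
Proof. by rewrite /lie_derivative dxM dyM; ring. Qed.

Lemma lie_order v n a : order_ge n.+1 a -> order_ge n (lie_derivative v a).
Proof.
move=> A; apply: order_geD; rewrite -[n]add0n; apply: order_geM => //.
  exact: dx_order.
exact: dy_order.
Qed.

Lemma lie_const v (c : K) : lie_derivative v (mon c 0 0) = 0.
Proof. by rewrite /lie_derivative dx_mon dy_mon !mulr0n !mon0 !mulr0 addr0. Qed.

Lemma lie_exp v a n :
  lie_derivative v (a ^+ n) = (a ^+ n.-1 *+ n) * lie_derivative v a.
Proof.
elim: n => [|n IH]; first by rewrite expr0 fps1E lie_const mulr0n mul0r.
rewrite exprS lieM IH; case: n IH => [|n] IH; first by rewrite expr0 mulr0n; ring.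
by rewrite !succnK [in RHS]mulrS [RHS]mulrDl [_ * (_ * _)]mulrA mulrnAr -exprS;
  congr (_ + _); apply: mulrC.
Qed.

(** The chain rule, for an arbitrary vector field in place of a partial
    derivative: this is the form in which conjugacies are computed. *)
Lemma lie_comp v a psi : fixes_origin psi ->
  lie_derivative v (fps_comp a psi) =
  fps_comp (fps_dx a) psi * lie_derivative v psi.1
  + fps_comp (fps_dy a) psi * lie_derivative v psi.2.
Proof.
move=> fx; move: a.
apply: (@eq_on_mon (fun a => lie_derivative v (fps_comp a psi))
  (fun a => fps_comp (fps_dx a) psi * lie_derivative v psi.1
  + fps_comp (fps_dy a) psi * lie_derivative v psi.2)).
- by move=> a b; rewrite fps_compD lieD.
- by move=> a b; rewrite dxD dyD !fps_compD; ring.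
- by move=> n a A; apply: lie_order; apply: fps_comp_order.
- move=> n a A; apply: order_geD; rewrite -[n]addn0; apply: order_geM => //.
    by apply: fps_comp_order => //; apply: dx_order.
  by apply: fps_comp_order => //; apply: dy_order.
move=> c k l; rewrite dx_mon dy_mon !fps_comp_mon // !lieM lie_const !lie_exp.
have monMn (d : K) m : mon (d *+ m) 0 0 = mon d 0 0 *+ m.
  by elim: m => [|m IH]; rewrite ?mulr0n ?mon0 // !mulrS monD IH.
by rewrite !monMn; ring.
Qed.

End Composition.

(** * Restriction to the x-axis and formal fixed points *)

Section DivRes.
Variable K : comNzRingType.
Implicit Types (a b : fps2 K) (phi psi : fps2 K * fps2 K).

Definition divY a : fps2 K := FPS2 (fun i j => a i j.+1).
Definition resY a : fps2 K := fps_in_x (fun i => a i 0%N).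

Lemma divYE a : a = resY a + fpsY * divY a.
Proof.
by apply/fps2P => i j; rewrite fpsD mul_fpsY /=; case: j => [|j] /=; rewrite ?addr0 ?add0r.
Qed.

Lemma resYD : {morph resY : a b / a + b}.
Proof. by move=> a b; apply/fps2P => i j /=; case: ifP; rewrite ?addr0. Qed.

(** Restriction to the x-axis is a substitution, hence a ring morphism. *)
Lemma resY_comp a : resY a = fps_comp a (fpsX, 0).
Proof.
have fx : @fixes_origin K (fpsX, 0) by [].
have cW n b : order_ge n.+1 b -> order_ge n b by apply: order_geW.
move: a; apply: (@eq_on_mon _ _ (fun a => fps_comp a (fpsX, 0))).
- exact: resYD.
- exact: fps_compD.
- by move=> n a /cW A i j lt /=; case: eqP lt => // -> lt; apply: A.
- by move=> n a /cW A; apply: fps_comp_order.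
move=> c k l; rewrite fps_comp_mon //=; case: l => [|l].
  transitivity (mon c k 0); first by apply/fps2P => i j /=; case: (j =P 0%N); rewrite ?andbF.
  rewrite -[in LHS](fps_comp_id (mon c k 0)) fps_comp_mon //=.
by rewrite exprS mul0r !mulr0; apply/fps2P => i j /=; rewrite andbF; case: ifP.
Qed.

Lemma resYM : {morph resY : a b / a * b}.
Proof. by move=> a b; rewrite !resY_comp fps_compM. Qed.

(** A series in x alone ignores the second component of the inner map, which may
    therefore be chosen freely. *)
Lemma fps_in_x_comp r psi (b : fps2 K) : fixes_origin psi -> fixes_origin (psi.1, b) ->
  fps_comp (fps_in_x r) psi = fps_comp (fps_in_x r) (psi.1, b).
Proof.
move=> f1 f2; have -> : fps_in_x r = resY (fps_in_x r) by apply/fps2P => i j /=; case: ifP.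
have fx : @fixes_origin K (fpsX, 0) by [].
have e : Defs.map_comp (fpsX, 0) psi = Defs.map_comp (fpsX, 0) (psi.1, b).
  by rewrite /Defs.map_comp !fps_compX // !fps_comp0.
by rewrite resY_comp (fps_compA _ fx f1) (fps_compA _ fx f2) e.
Qed.

Lemma dy_in_x r : fps_dy (fps_in_x r) = 0 :> fps2 K.
Proof. by apply/fps2P => i j /=; rewrite mul0rn. Qed.

Definition agree n psi psi' :=
  order_ge n (psi.1 - psi'.1) /\ order_ge n (psi.2 - psi'.2).

Lemma agree_trans n psi psi' chi : agree n psi psi' -> agree n psi' chi -> agree n psi chi.
Proof.
move=> [A1 A2] [B1 B2]; split.
  by have := order_geD A1 B1; rewrite addrA subrK.
by have := order_geD A2 B2; rewrite addrA subrK.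
Qed.

Lemma agreeW m n psi psi' : (n <= m)%N -> agree m psi psi' -> agree n psi psi'.
Proof. by move=> le [A B]; split; apply: order_geW le _. Qed.

Lemma agree_eq psi psi' : (forall n, agree n psi psi') -> psi = psi'.
Proof.
move=> A; rewrite [psi]surjective_pairing [psi']surjective_pairing.
congr pair; apply/fps2P => i j; apply/eqP; rewrite -subr_eq0 -fpsB; apply/eqP.
  by apply: (A (i + j).+1).1.
by apply: (A (i + j).+1).2.
Qed.

(** A map of pairs of series that gains one order of agreement at each step has a
    fixed point, the limit of the iterates from 0. The last clause lets every
    bound on the coefficients of the iterates pass to the limit, which is how
    convergence of formal solutions is proved. *)
Lemma fps_fixpoint (T : fps2 K * fps2 K -> fps2 K * fps2 K) :
    (forall psi, fixes_origin psi -> fixes_origin (T psi)) ->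
    (forall n psi psi', fixes_origin psi -> fixes_origin psi' ->
       agree n.+1 psi psi' -> agree n.+2 (T psi) (T psi')) ->
  exists psi, [/\ fixes_origin psi, T psi = psi &
                  forall n, agree n psi (iter n T (0, 0))].
Proof.
move=> Tf Tc; pose s n := iter n T (0, 0).
have sf n : fixes_origin (s n) by elim: n => [|n IH]; [split|apply: Tf].
have f1 psi psi' : fixes_origin psi -> fixes_origin psi' -> agree 1 psi psi'.
  by move=> [a b] [c d]; split; apply/order_ge1; rewrite fpsB ?(a, b, c, d) subrr.
have s1 n : agree n.+1 (s n.+1) (s n).
  by elim: n => [|n IH]; [exact: f1 (sf 1%N) (sf 0%N)|exact: Tc (sf _) (sf _) IH].
have sn m n : (n <= m)%N -> agree n.+1 (s m) (s n).
  move=> /subnK <-; elim: (m - n)%N => [|p IH]; first by split; rewrite subrr.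
  by apply: agree_trans IH; apply: agreeW (s1 (p + n)%N); lia.
(* The coefficients of total degree n are stationary from the n-th iterate on. *)
pose psi : fps2 K * fps2 K := (FPS2 (fun i j => (s (i + j)%N).1 i j),
             FPS2 (fun i j => (s (i + j)%N).2 i j)).
have ps n : agree n.+1 psi (s n).
  split=> i j lt; apply/eqP; rewrite fpsB /= subr_eq0 eq_sym -subr_eq0 -fpsB;
    apply/eqP.
    by have [H _] := @sn n (i + j)%N lt; apply: H.
  by have [_ H] := @sn n (i + j)%N lt; apply: H.
have fp : fixes_origin psi by split.
exists psi; split=> //; last by move=> n; apply: agreeW (ps n).
apply: agree_eq => n; apply: (@agree_trans _ _ (s n.+1)).
  by apply: agreeW (Tc n _ _ fp (sf n) (ps n)); lia.
have [A B] := ps n.+1; apply: (@agreeW n.+2); first lia.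
by split; rewrite -opprB; apply: order_geN.
Qed.

End DivRes.

(** * Weighted absolute sums of coefficients *)

Section Norm.
Variable K : numFieldType.
Implicit Types (a b : fps2 K) (phi psi v w : fps2 K * fps2 K) (rho C D : K).

(** Bounds on all finite partial sums stand for a bound on the infinite sum, so that
    no completeness is involved. The ranges are squares because these behave best
    under multiplication. *)
Definition nrm n rho a : K := \sum_(i < n) \sum_(j < n) `|a i j| * rho ^+ (i + j).
Definition norm_le rho a C := forall n, nrm n rho a <= C.

Lemma nrm_ge0 n rho a : 0 <= rho -> 0 <= nrm n rho a.
Proof. by move=> r0; do 2 apply: sumr_ge0 => ? _; rewrite mulr_ge0 // exprn_ge0. Qed.

Lemma norm_le_ge0 rho a C : norm_le rho a C -> 0 <= C.
Proof. by move=> /(_ 0%N); rewrite /nrm big_ord0. Qed.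

Lemma norm_le0 rho C : 0 <= C -> norm_le rho (0 : fps2 K) C.
Proof.
by move=> C0 m; rewrite /nrm big1 // => i _; rewrite big1 // => j _; rewrite normr0 mul0r.
Qed.

Lemma norm_leW rho a C D : C <= D -> norm_le rho a C -> norm_le rho a D.
Proof. by move=> CD A n; apply: le_trans CD. Qed.

Lemma nrmD n rho a b : 0 <= rho -> nrm n rho (a + b) <= nrm n rho a + nrm n rho b.
Proof.
move=> r0; rewrite -big_split; apply: ler_sum => i _; rewrite -big_split /=.
by apply: ler_sum => j _; rewrite -mulrDl ler_wpM2r ?exprn_ge0 // ler_normD.
Qed.

Lemma nrmN n rho a : nrm n rho (- a) = nrm n rho a.
Proof. by apply: eq_bigr => i _; apply: eq_bigr => j _; rewrite fpsN normrN. Qed.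

Lemma nrm_mon n rho c k l : 0 <= rho -> nrm n rho (mon c k l) <= `|c| * rho ^+ (k + l).
Proof.
move=> r0; have c0 : 0 <= `|c| * rho ^+ (k + l) by rewrite mulr_ge0 ?exprn_ge0.
rewrite /nrm; apply: (@le_trans _ _
  (\sum_(i < n) if i == k :> nat then `|c| * rho ^+ (k + l) else 0)).
  apply: ler_sum => i _ /=; case: eqP => [->|_] /=; last first.
    by rewrite big1 // => j _; rewrite normr0 mul0r.
  apply: (@le_trans _ _
    (\sum_(j < n) if j == l :> nat then `|c| * rho ^+ (k + l) else 0)).
    by apply: ler_sum => j _; case: eqP => [->|_] //; rewrite normr0 mul0r.
  rewrite -big_mkcond (big_ord1_eq _ (fun => `|c| * rho ^+ (k + l))).
  by case: ifP.
by rewrite -big_mkcond (big_ord1_eq _ (fun => `|c| * rho ^+ (k + l))); case: ifP.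
Qed.

Lemma sum_antidiagonals (V : nmodType) (G : nat -> nat -> V) m :
  \sum_(n < m) \sum_(i < n.+1) G i (n - i)%N =
  \sum_(i < m) \sum_(j < m) if (i + j < m)%N then G i j else 0.
Proof.
have E (n : 'I_m) : \sum_(i < n.+1) G i (n - i)%N =
    \sum_(i < m) \sum_(j < m) if (i + j == n)%N then G i j else 0.
  rewrite (big_ord_widen m (fun i => G i (n - i)%N)) // big_mkcond.
  apply: eq_bigr => i _; case: ltnP => [le|lt].
    have ji : (n - i < m)%N by have := ltn_ord n; lia.
    rewrite (bigD1 (Ordinal ji)) //= subnKC // eqxx big1 ?addr0 // => j.
    by rewrite -val_eqE /= => /eqP ne; case: eqP => // e; case: ne; lia.
  by rewrite big1 // => j _; case: eqP => // e; lia.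
rewrite (eq_bigr _ (fun n _ => E n)) exchange_big /=; apply: eq_bigr => i _.
rewrite exchange_big /=; apply: eq_bigr => j _.
case: ltnP => [lt|ge]; last first.
  by rewrite big1 // => n _; case: eqP => // e; have := ltn_ord n; lia.
rewrite (bigD1 (Ordinal lt)) //= eqxx big1 ?addr0 // => n.
by rewrite -val_eqE /= eq_sym => /negbTE ->.
Qed.

(** The triangle i + j < n is contained in the square of side n. *)
Lemma triangle_sum n (G : nat -> nat -> K) : (forall k m, 0 <= G k m) ->
  \sum_(i < n) \sum_(k < i.+1) G k (i - k)%N <= \sum_(k < n) \sum_(m < n) G k m.
Proof.
move=> G0; rewrite sum_antidiagonals; apply: ler_sum => k _; apply: ler_sum => m _.
by case: ifP.
Qed.

(** Submultiplicativity already holds for the partial sums: each coefficient of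
    the product is a sum over antidiagonals, in i and in j. *)
Lemma nrmM n rho a b : 0 <= rho -> nrm n rho (a * b) <= nrm n rho a * nrm n rho b.
Proof.
move=> r0; pose g k l := `|a k l| * rho ^+ (k + l); pose h k l := `|b k l| * rho ^+ (k + l).
have g0 k l : 0 <= g k l by rewrite mulr_ge0 ?exprn_ge0.
have h0 k l : 0 <= h k l by rewrite mulr_ge0 ?exprn_ge0.
apply: (@le_trans _ _ (\sum_(i < n) \sum_(k < i.+1) \sum_(j < n) \sum_(l < j.+1)
   g k l * h (i - k)%N (j - l)%N)).
  apply: ler_sum => i _; rewrite [leRHS]exchange_big; apply: ler_sum => j _.
  rewrite fpsM; apply: (le_trans (ler_wpM2r _ (ler_norm_sum _ _ _))); first exact: exprn_ge0.
  rewrite mulr_suml; apply: ler_sum => k _.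
  apply: (le_trans (ler_wpM2r _ (ler_norm_sum _ _ _))); first exact: exprn_ge0.
  rewrite mulr_suml; apply: ler_sum => l _; rewrite normrM /g /h.
  have := ltn_ord k; have := ltn_ord l; rewrite !ltnS => lj ki.
  have -> : (i + j = (k + l) + ((i - k) + (j - l)))%N by lia.
  by rewrite exprD mulrACA.
have := @triangle_sum n (fun k m => \sum_(j < n) \sum_(l < j.+1) g k l * h m (j - l)%N).
move=> /(_ _)/le_trans; apply.
  by move=> k m; do 2 apply: sumr_ge0 => ? _; apply: mulr_ge0.
rewrite /nrm mulr_suml; apply: ler_sum => k _; rewrite mulr_sumr; apply: ler_sum => m _.
have := @triangle_sum n (fun l q => g k l * h m q) => /(_ _)/le_trans; apply.
  by move=> ? ?; apply: mulr_ge0.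
rewrite mulr_suml; apply: ler_sum => l _; rewrite mulr_sumr; exact: ler_sum.
Qed.

Lemma norm_leD rho a b C D : 0 <= rho ->
  norm_le rho a C -> norm_le rho b D -> norm_le rho (a + b) (C + D).
Proof. by move=> r0 A B n; apply: (le_trans (nrmD _ _ _ r0)); apply: lerD. Qed.

Lemma norm_leN rho a C : norm_le rho a C -> norm_le rho (- a) C.
Proof. by move=> A n; rewrite nrmN. Qed.

Lemma norm_leB rho a b C D : 0 <= rho ->
  norm_le rho a C -> norm_le rho b D -> norm_le rho (a - b) (C + D).
Proof. by move=> r0 A B; apply: norm_leD => //; apply: norm_leN. Qed.

Lemma norm_leM rho a b C D : 0 <= rho ->
  norm_le rho a C -> norm_le rho b D -> norm_le rho (a * b) (C * D).
Proof.
by move=> r0 A B n; apply: (le_trans (nrmM _ _ _ r0)); apply: ler_pM => //; apply: nrm_ge0.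
Qed.

Lemma norm_le_mon rho c k l : 0 <= rho -> norm_le rho (mon c k l) (`|c| * rho ^+ (k + l)).
Proof. by move=> r0 n; apply: nrm_mon. Qed.

Lemma norm_leX rho : 0 <= rho -> norm_le rho fpsX rho.
Proof. by move=> r0; have := norm_le_mon 1 1 0 r0; rewrite normr1 mul1r -fpsXE. Qed.
Lemma norm_leY rho : 0 <= rho -> norm_le rho fpsY rho.
Proof. by move=> r0; have := norm_le_mon 1 0 1 r0; rewrite normr1 mul1r -fpsYE. Qed.
Lemma norm_le1 rho : 0 <= rho -> norm_le rho 1 1.
Proof. by move=> r0; have := norm_le_mon 1 0 0 r0; rewrite normr1 mul1r -fps1E. Qed.

Lemma norm_le_exp rho a C m : 0 <= rho -> norm_le rho a C -> norm_le rho (a ^+ m) (C ^+ m).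
Proof.
move=> r0 A; elim: m => [|m IH]; first by rewrite !expr0; apply: norm_le1.
by rewrite !exprS; apply: norm_leM.
Qed.

Lemma norm_le_sum (I : Type) (r : seq I) rho (F : I -> fps2 K) (c : I -> K) :
  0 <= rho -> (forall x, norm_le rho (F x) (c x)) ->
  norm_le rho (\sum_(x <- r) F x) (\sum_(x <- r) c x).
Proof.
move=> r0 H; elim/big_rec2: _ => [|x y1 y2 _ IH]; last exact: norm_leD.
exact: norm_le0.
Qed.

(** Substitution is bounded as soon as the components of the inner map are bounded
    by the radius of the outer series: expand in monomials and use that the norm
    is submultiplicative. *)
Lemma norm_le_comp rho rho' a psi C : 0 <= rho -> fixes_origin psi ->
  norm_le rho' a C -> norm_le rho psi.1 rho' -> norm_le rho psi.2 rho' ->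
  norm_le rho (fps_comp a psi) C.
Proof.
move=> r0 fx A P1 P2 n.
pose t : fps2 K := \sum_(k < n + n) \sum_(l < n + n)
  mon (a k l) 0 0 * (psi.1 ^+ k * psi.2 ^+ l).
have -> : nrm n rho (fps_comp a psi) = nrm n rho t.
  apply: eq_bigr => i _; apply: eq_bigr => j _; congr (`|_| * _).
  rewrite (@fps_comp_coefE _ (n + n)%N) //; last first.
    by have := ltn_ord i; have := ltn_ord j; lia.
  rewrite /t fps_sum; apply: eq_bigr => k _; rewrite fps_sum; apply: eq_bigr => l _.
  by rewrite mon_mulE !subn0.
apply: (le_trans (y := nrm (n + n) rho' a)) (A _).
(* The bound on t holds at every truncation, not only at n. *)
move: n @t => n; set N := (n + n)%N; move=> t.
suff H : norm_le rho t (nrm N rho' a) by [].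
apply: norm_le_sum => // k; apply: norm_le_sum => // l.
apply: norm_leM => //.
  by have := norm_le_mon (a k l) 0 0 r0; rewrite expr0 mulr1.
by rewrite exprD; apply: norm_leM => //; apply: norm_le_exp.
Qed.

Lemma nrm_le_coef n rho rho' a b c :
  (forall i j, `|a i j| * rho ^+ (i + j) <= c * (`|b i j| * rho' ^+ (i + j))) ->
  nrm n rho a <= c * nrm n rho' b.
Proof.
move=> H; rewrite /nrm mulr_sumr; apply: ler_sum => i _.
by rewrite mulr_sumr; apply: ler_sum.
Qed.

Lemma norm_le_coef rho rho' a b c C : 0 <= c ->
  (forall i j, `|a i j| * rho ^+ (i + j) <= c * (`|b i j| * rho' ^+ (i + j))) ->
  norm_le rho' b C -> norm_le rho a (c * C).
Proof.
by move=> c0 H B n; apply: (le_trans (nrm_le_coef n H)); apply: ler_wpM2l.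
Qed.

(** Shrinking the radius by eps gains a factor eps for each order of vanishing;
    this is the source of all small constants. *)
Lemma norm_le_scale m rho eps a C : 0 <= rho -> 0 <= eps -> eps <= 1 ->
  order_ge m a -> norm_le rho a C -> norm_le (eps * rho) a (eps ^+ m * C).
Proof.
move=> r0 e0 e1 A; apply: norm_le_coef; first exact: exprn_ge0.
move=> i j; have [lt|le] := ltnP (i + j) m.
  by rewrite A // normr0 !mul0r mulr0.
rewrite exprMn mulrCA ler_wpM2r ?mulr_ge0 ?exprn_ge0 //.
by rewrite -(subnKC le) exprD ler_piMr ?exprn_ge0 // exprn_ile1.
Qed.

(** The primitive in x that vanishes on the y-axis, divided by x. Dividing by x
    leaves the norm under control at a fixed radius, and the primitive itself is
    [fpsX * prim_divX a]. *)
Definition prim_divX a : fps2 K := FPS2 (fun i j => a i j / i.+1%:R).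

Lemma norm_le_prim rho a C : 0 <= rho -> norm_le rho a C -> norm_le rho (prim_divX a) C.
Proof.
move=> r0 A; rewrite -[C]mul1r; apply: norm_le_coef A => // i j.
rewrite mul1r ler_wpM2r ?exprn_ge0 //= normrM ler_piMr // normrV ?unitfE ?pnatr_eq0 //.
by rewrite normr_nat invf_le1 ?ltr0n // ler1n.
Qed.

Lemma norm_le_resY rho a C : 0 <= rho -> norm_le rho a C -> norm_le rho (resY a) C.
Proof.
move=> r0 A; rewrite -[C]mul1r; apply: norm_le_coef A => // i j.
rewrite mul1r ler_wpM2r ?exprn_ge0 //=; case: eqP => [->|] //.
by rewrite normr0.
Qed.

Lemma norm_le_divY rho a C : 0 < rho -> norm_le rho a C -> norm_le rho (divY a) (rho^-1 * C).
Proof.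
move=> r0 A n; apply: le_trans (ler_wpM2l _ (A n.+1)); last by rewrite invr_ge0 ltW.
rewrite /nrm mulr_sumr [leRHS]big_ord_recr /=.
have g0 i j : 0 <= `|a i j| * rho ^+ (i + j) by rewrite mulr_ge0 ?exprn_ge0 // ltW.
have i0 : 0 <= rho^-1 by rewrite invr_ge0 ltW.
rewrite -[leLHS]addr0; apply: lerD; last by rewrite mulr_ge0 // sumr_ge0.
apply: ler_sum => i _; rewrite mulr_sumr big_ord_recl /= -[leLHS]add0r; apply: lerD.
  by rewrite mulr_ge0.
apply: ler_sum => j _; rewrite /bump /= add1n addnS exprS.
by rewrite mulrCA mulKf ?gt_eqF.
Qed.

(** Halving the radius absorbs the factor i of a derivative, since
    i.+1 <= 2 ^ i.+1. *)
Lemma norm_le_dx rho a C : 0 < rho ->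
  norm_le rho a C -> norm_le (rho / 2) (fps_dx a) (2 / rho * C).
Proof.
move=> r0 A n; apply: le_trans (ler_wpM2l _ (A n.+1)); last by rewrite divr_ge0 // ltW.
rewrite /nrm mulr_sumr big_ord_recl /=.
have g0 i j : 0 <= `|a i j| * rho ^+ (i + j) by rewrite mulr_ge0 ?exprn_ge0 // ltW.
have i0 : 0 <= 2 / rho by rewrite divr_ge0 // ltW.
rewrite -[leLHS]add0r; apply: lerD; first by rewrite mulr_ge0 // sumr_ge0.
apply: ler_sum => i _; rewrite mulr_sumr [leRHS]big_ord_recr /= -[leLHS]addr0; apply: lerD.
  apply: ler_sum => j _; rewrite /bump /= add1n addSn exprS.
  have -> : 2 / rho * (`|a i.+1 j| * (rho * rho ^+ (i + j))) =
     `|a i.+1 j| * (2 * rho ^+ (i + j)) by field; rewrite gt_eqF.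
  rewrite normrMn -[`|_| *+ _]mulr_natr -mulrA ler_wpM2l // expr_div_n mulrCA [leRHS]mulrC.
  rewrite ler_wpM2l ?exprn_ge0 ?(ltW r0) // ler_pdivrMr ?exprn_gt0 ?ltr0n //.
  rewrite -exprS -natrX ler_nat.
  have := ltn_expl i (isT : 1 < 2)%N; rewrite expnS expnD.
  have := expn_gt0 2 j; nia.
by rewrite mulr_ge0.
Qed.

Lemma norm_le_dy rho a C : 0 < rho ->
  norm_le rho a C -> norm_le (rho / 2) (fps_dy a) (2 / rho * C).
Proof.
pose tr b : fps2 K := FPS2 (fun i j => b j i).
have trE n r b : nrm n r (tr b) = nrm n r b.
  rewrite /nrm exchange_big; apply: eq_bigr => i _; apply: eq_bigr => j _ /=.
  by rewrite addnC.
move=> r0 A n; rewrite -trE; apply: (norm_le_dx (a := tr a)) => // m.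
by rewrite trE.
Qed.

End Norm.

(** * Summable series and the inverse function theorem *)

Local Opaque fps_comp fps2_mul.

Section Conv.
Variable K : numFieldType.
Implicit Types (a b e h : fps2 K) (phi psi v w : fps2 K * fps2 K) (rho C D : K).

(** Requirements on the radius are collected by [small_and]; a single radius meeting
    all of them is chosen at the end, by [small_ex]. *)
Definition small (P : K -> Prop) :=
  exists2 rho0, 0 < rho0 & forall rho, 0 < rho -> rho <= rho0 -> P rho.

Lemma small_and P Q : small P -> small Q -> small (fun rho => P rho /\ Q rho).
Proof.
move=> [r r0 Pr] [s s0 Qs]; have rs0 : 0 < r + s by apply: addr_gt0.
exists (r * s / (r + s)) => [|t t0 tle]; first by rewrite divr_gt0 ?mulr_gt0.
split; [apply: Pr|apply: Qs] => //; apply: (le_trans tle).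
  by rewrite ler_pdivrMr // ler_pM2l // lerDr ltW.
by rewrite ler_pdivrMr // mulrC ler_pM2l // lerDl ltW.
Qed.

Lemma small_sub (P Q : K -> Prop) :
  (forall rho, 0 < rho -> P rho -> Q rho) -> small P -> small Q.
Proof. by move=> PQ [r r0 Pr]; exists r => // t t0 tr; apply: PQ => //; apply: Pr. Qed.

Lemma small_le C : 0 < C -> small (fun rho => rho <= C).
Proof. by exists C. Qed.

Lemma small_mul_le C D : 0 <= C -> 0 < D -> small (fun rho => C * rho <= D).
Proof.
move=> C0 D0; have C1 : 0 < C + 1 by apply: ltr_wpDl.
apply: small_sub (small_le (divr_gt0 D0 C1)) => rho r0.
rewrite ler_pdivlMr // mulrC => /(le_trans _); apply.
by rewrite ler_wpM2r ?(ltW r0) // lerDl.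
Qed.

Lemma small_dilate (P : K -> Prop) c : 0 < c -> small P -> small (fun rho => P (c * rho)).
Proof.
move=> c0 [r r0 Pr]; exists (r / c) => [|t t0 tle]; first exact: divr_gt0.
by apply: Pr; rewrite ?mulr_gt0 // mulrC -ler_pdivlMr.
Qed.

Lemma small_ex (P : K -> Prop) : small P -> exists2 rho, 0 < rho & P rho.
Proof. by move=> [r r0 Pr]; exists r => //; apply: Pr. Qed.

Definition summable a := exists2 rho, 0 < rho & exists C, norm_le rho a C.

Lemma summable_order m a : order_ge m a -> summable a ->
  exists2 C, 0 <= C & small (fun rho => norm_le rho a (C * rho ^+ m)).
Proof.
move=> A [r r0 [C H]]; exists (C / r ^+ m).
  by rewrite divr_ge0 ?exprn_ge0 ?(ltW r0) //; apply: norm_le_ge0 H.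
exists r => // t t0 tr.
have -> : C / r ^+ m * t ^+ m = (t / r) ^+ m * C.
  by rewrite expr_div_n mulrC mulrA mulrAC.
rewrite -[X in norm_le X](divfK (lt0r_neq0 r0)).
apply: norm_le_scale => //; rewrite ?(ltW r0) ?divr_ge0 ?(ltW r0) ?(ltW t0) //.
by rewrite ler_pdivrMr // mul1r.
Qed.

Lemma summable_small a : summable a -> exists2 C, 0 <= C & small (fun rho => norm_le rho a C).
Proof.
move=> /(summable_order (order_ge0 a))[C C0 H]; exists C => //.
by apply: small_sub H => rho _; rewrite expr0 mulr1.
Qed.

Lemma small_summable a C : small (fun rho => norm_le rho a C) -> summable a.
Proof. by move=> /small_ex[r r0 H]; exists r => //; exists C. Qed.

Lemma summableD a b : summable a -> summable b -> summable (a + b).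
Proof.
move=> /summable_small[C _ A] /summable_small[D _ B]; apply: (@small_summable _ (C + D)).
by apply: small_sub (small_and A B) => r r0 []; apply: norm_leD; apply: ltW.
Qed.

Lemma summableN a : summable a -> summable (- a).
Proof. by move=> [r r0 [C A]]; exists r => //; exists C; apply: norm_leN. Qed.

Lemma summableB a b : summable a -> summable b -> summable (a - b).
Proof. by move=> A B; apply/summableD/summableN. Qed.

Lemma summableM a b : summable a -> summable b -> summable (a * b).
Proof.
move=> /summable_small[C _ A] /summable_small[D _ B]; apply: (@small_summable _ (C * D)).
by apply: small_sub (small_and A B) => r r0 []; apply: norm_leM; apply: ltW.
Qed.

Lemma summableX : summable fpsX. Proof. by exists 1 => //; exists 1; apply: norm_leX. Qed.
Lemma summableY : summable fpsY. Proof. by exists 1 => //; exists 1; apply: norm_leY. Qed.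
Lemma summable1 : summable 1. Proof. by exists 1 => //; exists 1; apply: norm_le1. Qed.

Lemma summable_prim a : summable a -> summable (prim_divX a).
Proof.
by move=> [r r0 [C A]]; exists r => //; exists C; apply: norm_le_prim (ltW r0) A.
Qed.
Lemma summable_resY a : summable a -> summable (resY a).
Proof.
by move=> [r r0 [C A]]; exists r => //; exists C; apply: norm_le_resY (ltW r0) A.
Qed.
Lemma summable_divY a : summable a -> summable (divY a).
Proof. by move=> [r r0 [C A]]; exists r => //; exists (r^-1 * C); apply: norm_le_divY. Qed.
Lemma summable_dx a : summable a -> summable (fps_dx a).
Proof.
move=> [r r0 [C A]]; exists (r / 2); first by rewrite divr_gt0.
by exists (2 / r * C); apply: norm_le_dx.
Qed.
Lemma summable_dy a : summable a -> summable (fps_dy a).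
Proof.
move=> [r r0 [C A]]; exists (r / 2); first by rewrite divr_gt0.
by exists (2 / r * C); apply: norm_le_dy.
Qed.

Lemma summable_comp a psi : fixes_origin psi ->
  summable a -> summable psi.1 -> summable psi.2 -> summable (fps_comp a psi).
Proof.
move=> fx [r r0 [C A]] P1 P2; have /fixesP[o1 o2] := fx.
have [C1 C10 H1] := summable_order o1 P1; have [C2 C20 H2] := summable_order o2 P2.
apply: (@small_summable _ C).
have := small_and (small_and H1 H2) (small_and (small_mul_le C10 r0) (small_mul_le C20 r0)).
apply: small_sub => s s0 [[N1 N2] [L1 L2]]; apply: (norm_le_comp (rho' := r)) => //.
- exact: ltW.
- by apply: norm_leW N1; rewrite expr1.
- by apply: norm_leW N2; rewrite expr1.
Qed.

Lemma agree_norm rho C psi (s : nat -> fps2 K * fps2 K) :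
  (forall n, agree n psi (s n)) ->
  (forall n, norm_le rho (s n).1 C) -> (forall n, norm_le rho (s n).2 C) ->
  norm_le rho psi.1 C /\ norm_le rho psi.2 C.
Proof.
move=> A H1 H2.
have E a b n : order_ge (n + n) (a - b) -> nrm n rho a = nrm n rho b.
  move=> o; apply: eq_bigr => i _; apply: eq_bigr => j _; congr (`|_| * _).
  apply/eqP; rewrite -subr_eq0 -fpsB o //.
  by have := ltn_ord i; have := ltn_ord j; lia.
by split=> n; have [A1 A2] := A (n + n)%N;
  [rewrite (E _ _ _ A1); apply: H1|rewrite (E _ _ _ A2); apply: H2].
Qed.

(** Writing phi = id + Z with Z of order 2, a right inverse is a fixed point of
    psi |-> id - Z o psi, which gains one order. If Z is summable then |Z| is
    O(rho^2) at radius 2 rho, hence at most rho, so the ball of radius 2 rho is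
    preserved by this map and contains its fixed point. *)
Lemma tangent_right_inverse phi : tangent_to_id phi ->
  exists psi, [/\ tangent_to_id psi, Defs.map_comp phi psi = (fpsX, fpsY)
    & summable phi.1 -> summable phi.2 -> summable psi.1 /\ summable psi.2].
Proof.
case; set Z1 := phi.1 - fpsX; set Z2 := phi.2 - fpsY => o1 o2.
pose T psi := (fpsX - fps_comp Z1 psi, fpsY - fps_comp Z2 psi).
have Tf psi : fixes_origin psi -> fixes_origin (T psi).
  move=> fx; split; rewrite fpsB.
    by rewrite (fps_comp_order fx o1) // subr0.
  by rewrite (fps_comp_order fx o2) // subr0.
have low a : order_ge 2 a -> forall k l, (0 < k + l < 2)%N -> a k l = 0.
  by move=> o k l /andP[_]; apply: o.
have Tc n psi psi' : fixes_origin psi -> fixes_origin psi' ->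
    agree n.+1 psi psi' -> agree n.+2 (T psi) (T psi').
  move=> f f' [A1 A2]; rewrite -[n.+2]addn2; split.
    have -> : (T psi).1 - (T psi').1 = - (fps_comp Z1 psi - fps_comp Z1 psi').
      by rewrite /T /= [RHS]opprB [in LHS]opprB addrC subrKA.
    by apply: order_geN; apply: fps_comp_congr => //; apply: low.
  have -> : (T psi).2 - (T psi').2 = - (fps_comp Z2 psi - fps_comp Z2 psi').
    by rewrite /T /= [RHS]opprB [in LHS]opprB addrC subrKA.
  by apply: order_geN; apply: fps_comp_congr => //; apply: low.
have [psi [fx Tpsi lim]] := fps_fixpoint Tf Tc.
have e1 : psi.1 = fpsX - fps_comp Z1 psi by rewrite -{1}Tpsi.
have e2 : psi.2 = fpsY - fps_comp Z2 psi by rewrite -{1}Tpsi.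
exists psi; split.
- split; [rewrite e1|rewrite e2]; rewrite addrAC subrr add0r;
    exact/order_geN/fps_comp_order.
- rewrite /Defs.map_comp -[phi.1](subrK fpsX) -[phi.2](subrK fpsY).
  rewrite (fps_compD _ Z1) (fps_compD _ Z2) fps_compX // fps_compY //.
  by congr pair; [rewrite e1|rewrite e2]; rewrite addrC subrK.
move=> c1 c2.
have [C1 C10 S1] := summable_order o1 (summableB c1 summableX).
have [C2 C20 S2] := summable_order o2 (summableB c2 summableY).
have fC C : 0 <= C -> small (fun rho => (C * 4) * rho <= 1).
  by move=> C0; apply: small_mul_le => //; rewrite mulr_ge0.
have := small_and (small_and (small_dilate (ltr0Sn K 1) S1) (small_dilate (ltr0Sn K 1) S2))
  (small_and (fC _ C10) (fC _ C20)).
move=> /small_ex[r r0 [[N1 N2] [L1 L2]]].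
have r2 : 0 <= 2 * r by rewrite mulr_ge0 // ltW.
have sf n : fixes_origin (iter n T (0, 0)) by elim: n => [|n IH]; [split|apply: Tf].
have bnd C : 0 <= C -> (C * 4) * r <= 1 -> r + C * (2 * r) ^+ 2 <= 2 * r.
  move=> C0 L; have -> : C * (2 * r) ^+ 2 = r * (C * 4 * r) by ring.
  by rewrite mulr_natl mulr2n lerD2l ler_piMr // ltW.
have it n : norm_le r (iter n T (0, 0)).1 (2 * r) /\ norm_le r (iter n T (0, 0)).2 (2 * r).
  elim: n => [|n [IH1 IH2]].
    by split; apply: norm_le0.
  rewrite iterS; split.
    apply: norm_leW (bnd _ C10 L1) (norm_leB (ltW r0) (norm_leX (ltW r0)) _).
    by apply: norm_le_comp N1 IH1 IH2; first exact: ltW.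
  apply: norm_leW (bnd _ C20 L2) (norm_leB (ltW r0) (norm_leY (ltW r0)) _).
  by apply: norm_le_comp N2 IH1 IH2; first exact: ltW.
have [] := agree_norm lim (fun n => (it n).1) (fun n => (it n).2).
by split; exists r => //; exists (2 * r).
Qed.

(** The right inverse psi has itself a right inverse chi, and
    phi = phi o (psi o chi) = chi. *)
Lemma tangent_inverse phi : tangent_to_id phi ->
  exists psi, [/\ tangent_to_id psi, Defs.map_comp phi psi = (fpsX, fpsY),
    Defs.map_comp psi phi = (fpsX, fpsY)
    & summable phi.1 -> summable phi.2 -> summable psi.1 /\ summable psi.2].
Proof.
move=> tp; have [psi [ts ps c]] := tangent_right_inverse tp.
have [chi [tc sc _]] := tangent_right_inverse ts.
exists psi; split; [exact: ts|exact: ps| |exact: c].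
have [fp fs fc] := And3 (tangent_fixes tp) (tangent_fixes ts) (tangent_fixes tc).
suff -> : phi = chi by [].
have id_comp (q : fps2 K * fps2 K) : Defs.map_comp q (fpsX, fpsY) = q.
  by rewrite /Defs.map_comp !fps_comp_id -surjective_pairing.
have comp_id (q : fps2 K * fps2 K) : fixes_origin q -> Defs.map_comp (fpsX, fpsY) q = q.
  by move=> f; rewrite /Defs.map_comp fps_compX // fps_compY // -surjective_pairing.
by rewrite -[LHS]id_comp -sc -map_fps_compA // ps comp_id.
Qed.

(** The series 1 / (1 + y). *)
Definition geom : fps2 K := FPS2 (fun i j => if i == 0%N then (-1) ^+ j else 0).

Lemma geomE : (1 + fpsY) * geom = 1.
Proof.
rewrite mulrDl mul1r; apply/fps2P => i j; rewrite fpsD mul_fpsY fps1E /=.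
case: i => [|i]; case: j => [|j] /=; rewrite ?addr0 ?expr0 //.
by rewrite exprS mulN1r addNr.
Qed.

Lemma summable_geom : summable geom.
Proof.
exists 2^-1; rewrite ?invr_gt0 //; exists 2 => n; case: n => [|n].
  by rewrite /nrm big_ord0.
rewrite /nrm big_ord_recl /= [X in _ + X]big1 ?addr0; last first.
  by move=> i _; rewrite big1 // => j _; rewrite normr0 mul0r.
move: n.+1 => m.
have -> : \sum_(j < m) `|(-1 : K) ^+ j| * 2^-1 ^+ (0 + j) = 2 - 2 * 2^-1 ^+ m.
  elim: m => [|m IH]; first by rewrite big_ord0 expr0 mulr1 subrr.
  by rewrite big_ord_recr /= IH normrX normrN1 expr1n exprS add0n; field.
by rewrite gerBl mulr_ge0 // exprn_ge0 // invr_ge0.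
Qed.

(** Substitute y := a - 1 in 1 / (1 + y). *)
Lemma unit_inverse a : a 0%N 0%N = 1 ->
  exists b, [/\ a * b = 1 & summable a -> summable b].
Proof.
move=> a1; have fx : fixes_origin (fpsX, a - 1) by split; rewrite // fpsB a1 fps1E /= subrr.
exists (fps_comp geom (fpsX, a - 1)); split=> [|ca].
  have {1}-> : a = fps_comp (1 + fpsY) (fpsX, a - 1).
    by rewrite fps_compD fps_comp1 // fps_compY // addrC subrK.
  by rewrite -fps_compM // geomE fps_comp1.
apply: summable_comp => //; [exact: summable_geom|exact: summableX|].
by apply: summableB => //; apply: summable1.
Qed.

End Conv.

(** * Ordinary differential equations in x with parameter y *)

Section ODE.
Variable K : numFieldType.
Implicit Types (a b e h S : fps2 K) (phi psi v w : fps2 K * fps2 K) (rho C D : K).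

Lemma order_geX1 : order_ge 1 (fpsX : fps2 K). Proof. exact/order_ge1. Qed.
Lemma mulX_order n a : order_ge n a -> order_ge n.+1 (fpsX * a).
Proof. by move=> A; rewrite -add1n; apply: order_geM => //; apply: order_geX1. Qed.

Lemma prim_order n a : order_ge n a -> order_ge n (prim_divX a).
Proof. by move=> A i j lt /=; rewrite A ?mul0r. Qed.

Lemma primB a b : prim_divX (a - b) = prim_divX a - prim_divX b.
Proof. by apply/fps2P => i j; rewrite fpsB /= mulrBl. Qed.

Lemma dx_prim a : fps_dx (fpsX * prim_divX a) = a.
Proof.
apply/fps2P => i j; transitivity ((fpsX * prim_divX a) i.+1 j *+ i.+1) => //.
by rewrite mul_fpsX -[RHS](divfK (_ : i.+1%:R != 0)) ?pnatr_eq0 // mulr_natr.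
Qed.

Lemma fixesXY b : b 0%N 0%N = 0 -> fixes_origin (fpsX, b).
Proof. by []. Qed.

Lemma fixes_flow S : fixes_origin (fpsX, fpsY + fpsX * S).
Proof. by apply: fixesXY; rewrite fpsD mul_fpsX addr0. Qed.

(** The case of one unknown, with balls that the map preserves. *)
Lemma fps_fixpoint1 (T : fps2 K -> fps2 K) :
    (forall a, T a 0%N 0%N = 0) ->
    (forall n a b, order_ge n.+1 (a - b) -> order_ge n.+2 (T a - T b)) ->
  exists a, [/\ a 0%N 0%N = 0, T a = a & forall rho C, 0 <= C ->
    (forall b, norm_le rho b C -> norm_le rho (T b) C) -> norm_le rho a C].
Proof.
move=> T0 Tc; pose T' (psi : fps2 K * fps2 K) := (T psi.1, 0 : fps2 K).
have [|n psi psi' _ _ [A _]|[a z] [[a0 _] Ta lim]] := @fps_fixpoint _ T'.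
- by move=> psi _; split; rewrite /= ?T0.
- by split; [apply: Tc|rewrite subrr].
exists a; split=> // [|rho C C0 H]; first by case: Ta.
have B n : norm_le rho (iter n T' (0, 0)).1 C /\ norm_le rho (iter n T' (0, 0)).2 C.
  elim: n => [|n [IH _]]; first by split; apply: norm_le0.
  by rewrite iterS; split; [apply: H|apply: norm_le0].
by have [] := agree_norm lim (fun n => (B n).1) (fun n => (B n).2).
Qed.

(** Writing the solution of Y' = h(x, Y) with Y(0, y) = y as Y = y + x S turns the
    equation into a fixed point equation for S that is well behaved at a fixed
    radius rho: if |S| <= 1 then |y + x S| <= 2 rho, and |h| <= 1 at radius 2 rho
    because h vanishes at the origin. *)
Lemma flow_exists h : h 0%N 0%N = 0 -> summable h ->
  exists S, [/\ S 0%N 0%N = 0,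
    S = prim_divX (fps_comp h (fpsX, fpsY + fpsX * S)) & summable S].
Proof.
move=> h0 ch; pose T S := prim_divX (fps_comp h (fpsX, fpsY + fpsX * S)).
have T0 S : T S 0%N 0%N = 0.
  by apply/order_ge1/prim_order/fps_comp_order; [apply: fixes_flow|apply/order_ge1].
have [n a b A|S [S0 TS bnd]] := @fps_fixpoint1 T T0.
  rewrite /T -primB; apply: prim_order; rewrite -addn1.
  apply: fps_comp_congr; try exact: fixes_flow.
  - by case=> [|k] [|l].
  - by rewrite subrr.
  - rewrite opprD addrACA subrr add0r -mulrBr; exact: mulX_order.
exists S; split=> //.
have [C C0 H] := summable_order (proj2 (order_ge1 h) h0) ch.
have [r r0 [N L]] := small_ex (small_and (small_dilate (ltr0Sn K 1) H)
  (small_mul_le (mulr_ge0 C0 (ler0n K 2)) ltr01)).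
exists r => //; exists 1; apply: bnd => // b B; apply: norm_le_prim; first exact: ltW.
apply: norm_leW L _; rewrite -mulrA -[X in _ * X]expr1.
apply: norm_le_comp N _ _; [exact: ltW|exact: fixes_flow| |].
  by apply: norm_leW (norm_leX (ltW r0)); rewrite mulr_natl mulr2n lerDl ltW.
rewrite mulr_natl mulr2n -[X in _ (r + X)]mulr1; apply: norm_leD; first exact: ltW.
  exact/norm_leY/ltW.
by apply: norm_leM => //; [exact: ltW|apply/norm_leX/ltW].
Qed.

(** The right-hand sides A(S) for which S' = A(S) is solved below: formally they do
    not lower the order of agreement of two series, and they are bounded on the unit
    ball at all small radii. The lemmas that follow show that all expressions built from summable series, S and
    substitutions a(x, e A(S)) with e(0) = 0 are of this kind, which avoids series
    in a third variable. *)
Definition tame (A : fps2 K -> fps2 K) :=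
  (forall n a b, order_ge n (a - b) -> order_ge n (A a - A b)) /\
  exists2 C, 0 <= C & small (fun rho => forall S, norm_le rho S 1 -> norm_le rho (A S) C).

Lemma tame_cst a : summable a -> tame (fun=> a).
Proof.
move=> /summable_small[C C0 H]; split=> [n b c _|]; first by rewrite subrr.
by exists C => //; apply: small_sub H.
Qed.

Lemma tame_id : tame id.
Proof. by split=> //; exists 1 => //; exists 1. Qed.

Lemma tameD A B : tame A -> tame B -> tame (fun S => A S + B S).
Proof.
move=> [Ac [C C0 AC]] [Bc [D D0 BD]]; split=> [n a b o|].
  by rewrite opprD addrACA; apply: order_geD; [apply: Ac|apply: Bc].
exists (C + D); first exact: addr_ge0.
apply: small_sub (small_and AC BD) => r r0 [HA HB] S NS.
by apply: norm_leD; [exact: ltW|apply: HA|apply: HB].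
Qed.

Lemma tameN A : tame A -> tame (fun S => - A S).
Proof.
move=> [Ac [C C0 AC]]; split=> [n a b o|].
  by rewrite -opprD; apply: order_geN; apply: Ac.
exists C => //; apply: small_sub AC => r r0 HA S NS.
by apply: norm_leN; apply: HA.
Qed.

Lemma tameB A B : tame A -> tame B -> tame (fun S => A S - B S).
Proof. by move=> tA tB; apply: tameD => //; apply: tameN. Qed.

Lemma tameM A B : tame A -> tame B -> tame (fun S => A S * B S).
Proof.
move=> [Ac [C C0 AC]] [Bc [D D0 BD]]; split=> [n a b o|].
  have -> : A a * B a - A b * B b = (A a - A b) * B a + A b * (B a - B b).
    by rewrite mulrBl mulrBr addrA subrK.
  apply: order_geD.
    by rewrite -[n]addn0; apply: order_geM (Ac _ _ _ o) (order_ge0 _).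
  by rewrite -[n]add0n; apply: order_geM (order_ge0 _) (Bc _ _ _ o).
exists (C * D); first exact: mulr_ge0.
apply: small_sub (small_and AC BD) => r r0 [HA HB] S NS.
by apply: norm_leM; [exact: ltW|apply: HA|apply: HB].
Qed.

Lemma fixes_mul e b : e 0%N 0%N = 0 -> fixes_origin (fpsX, e * b).
Proof.
move=> e0; apply: fixesXY; apply/order_ge1; rewrite -[1%N]addn0.
by apply: order_geM => //; apply/order_ge1.
Qed.

(** The factor e, being small at small radii, keeps the inner map in the domain of
    convergence of a. *)
Lemma tame_comp a e A : summable a -> summable e -> e 0%N 0%N = 0 -> tame A ->
  tame (fun S => fps_comp a (fpsX, e * A S)).
Proof.
move=> [r0 r00 [Ca Na]] ce e0 [Ac [C C0 AC]]; split=> [[//|n] b c o|].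
  rewrite -addn1; apply: fps_comp_congr; try exact: fixes_mul.
  - by case=> [|k] [|l].
  - by rewrite subrr.
  - by rewrite -mulrBr -[n.+1]add0n; apply: order_geM => //; apply: Ac.
have [D D0 De] := summable_order (proj2 (order_ge1 e) e0) ce.
exists Ca; first exact: norm_le_ge0 Na.
have sm := small_and (small_le r00) (small_mul_le (mulr_ge0 D0 C0) r00).
apply: small_sub (small_and (small_and AC De) sm) => r rp [[HA Ne] [L1 L2]] S NS.
apply: norm_le_comp Na _ _; [exact: ltW|exact: fixes_mul| |].
  by apply: norm_leW L1 _; apply/norm_leX/ltW.
apply: norm_leW L2 _; rewrite mulrAC -[X in D * X]expr1.
by apply: norm_leM => //; [exact: ltW|apply: HA].
Qed.

(** The primitive in x gains one order and, at radius rho, a factor rho; for small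
    rho it therefore maps the unit ball to itself. *)
Lemma tame_ode A : tame A ->
  exists S, [/\ S 0%N 0%N = 0, fps_dx S = A S & summable S].
Proof.
move=> [Ac [C C0 AC]]; pose T S := fpsX * prim_divX (A S).
have [S|n a b o|S [S0 TS bnd]] := @fps_fixpoint1 T; first by rewrite mul_fpsX.
  by rewrite /T -mulrBr -primB; apply/mulX_order/prim_order/Ac.
exists S; split=> //; first by rewrite -{1}TS dx_prim.
have [r r0 [HA L]] := small_ex (small_and AC (small_mul_le C0 ltr01)).
exists r => //; exists 1; apply: bnd => // b B; apply: norm_leW L _.
rewrite mulrC; apply: norm_leM; [exact: ltW|exact/norm_leX/ltW|].
by apply: norm_le_prim; [exact: ltW|apply: HA].
Qed.

End ODE.

(** * Conjugacy and the straightening of the foliation *)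

Section Steps.
Variable K : numFieldType.
Implicit Types (a b c f g h F H S : fps2 K) (phi psi v w : fps2 K * fps2 K).

Lemma dxX : fps_dx fpsX = 1 :> fps2 K.
Proof. by rewrite fpsXE dx_mon mulr1n -fps1E. Qed.
Lemma dyX : fps_dy fpsX = 0 :> fps2 K.
Proof. by rewrite fpsXE dy_mon mulr0n mon0. Qed.
Lemma dxY : fps_dx fpsY = 0 :> fps2 K.
Proof. by rewrite fpsYE dx_mon mulr0n mon0. Qed.
Lemma dyY : fps_dy fpsY = 1 :> fps2 K.
Proof. by rewrite fpsYE dy_mon mulr1n -fps1E. Qed.

Lemma lieX v : lie_derivative v fpsX = v.1.
Proof. by rewrite /lie_derivative dxX dyX mulr1 mulr0 addr0. Qed.
Lemma lieY v : lie_derivative v fpsY = v.2.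
Proof. by rewrite /lie_derivative dxY dyY mulr1 mulr0 add0r. Qed.
Lemma lie_dx a : lie_derivative (1, 0) a = fps_dx a.
Proof. by rewrite /lie_derivative mul1r mul0r addr0. Qed.
Lemma lie_dy a : lie_derivative (0, 1) a = fps_dy a.
Proof. by rewrite /lie_derivative mul1r mul0r add0r. Qed.

Lemma fps_comp00 a psi : fixes_origin psi -> fps_comp a psi 0%N 0%N = a 0%N 0%N.
Proof.
move=> fx; rewrite (@fps_comp_coefE _ 1%N) // !big_ord1 !expr0 mul1r.
by rewrite fps1E /= mulr1.
Qed.

(** D phi . v = w o phi, which is [pushforward phi psi v = w] without mention of
    the inverse psi. *)
Definition conjugates phi v w :=
  lie_derivative v phi.1 = fps_comp w.1 phi /\ lie_derivative v phi.2 = fps_comp w.2 phi.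

(** Tangency to the identity makes every such phi invertible, by
    [tangent_inverse]. *)
Definition analytically_conjugate v w := exists phi,
  [/\ tangent_to_id phi, summable phi.1, summable phi.2 & conjugates phi v w].

Lemma lie_conjugates phi v w a : fixes_origin phi -> conjugates phi v w ->
  lie_derivative v (fps_comp a phi) = fps_comp (lie_derivative w a) phi.
Proof.
move=> fx [c1 c2]; rewrite lie_comp // c1 c2 /lie_derivative fps_compD !fps_compM //.
by rewrite ![_ * fps_comp (w.1) _]mulrC ![_ * fps_comp (w.2) _]mulrC.
Qed.

Lemma tangent_comp phi psi : tangent_to_id phi -> tangent_to_id psi ->
  tangent_to_id (Defs.map_comp phi psi).
Proof.
move=> [p1 p2] ts; have fs := tangent_fixes ts; have [s1 s2] := ts; split.
  have -> : (Defs.map_comp phi psi).1 - fpsX =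
     fps_comp (phi.1 - fpsX) psi + (psi.1 - fpsX).
    by rewrite fps_compB fps_compX // addrA subrK.
  by apply: order_geD => //; apply: fps_comp_order.
have -> : (Defs.map_comp phi psi).2 - fpsY =
   fps_comp (phi.2 - fpsY) psi + (psi.2 - fpsY).
  by rewrite fps_compB fps_compY // addrA subrK.
by apply: order_geD => //; apply: fps_comp_order.
Qed.

Lemma analytically_conjugate_trans v w u :
  analytically_conjugate v w -> analytically_conjugate w u ->
  analytically_conjugate v u.
Proof.
move=> [phi [tp c1 c2 cj]] [chi [tc d1 d2 [cj1 cj2]]].
have [fp fc] := conj (tangent_fixes tp) (tangent_fixes tc).
exists (Defs.map_comp chi phi); split.
- exact: tangent_comp.
- exact: summable_comp.
- exact: summable_comp.
split; rewrite (lie_conjugates _ fp cj).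
  by rewrite cj1; apply: fps_compA fc fp.
by rewrite cj2; apply: fps_compA fc fp.
Qed.

Lemma unit_cancel a b : a * b = 0 -> b 0%N 0%N != 0 -> a = 0.
Proof.
move=> ab b0; have [] := @unit_inverse K (mon (b 0%N 0%N)^-1 0 0 * b).
  by rewrite mon_mulE subnn mulVf.
move=> c [bc _]; rewrite -[a]mulr1 -bc.
have -> : a * (mon (b 0%N 0%N)^-1 0 0 * b * c) = a * b * (mon (b 0%N 0%N)^-1 0 0 * c).
  by rewrite -!mulrA; congr (_ * _); rewrite mulrCA.
by rewrite ab mul0r.
Qed.

Lemma resY_mulY a : resY (fpsY * a) = 0.
Proof. by apply/fps2P => i j /=; case: eqP => // _; rewrite mul_fpsY. Qed.

Lemma order_ge_lin a : order_ge 2 a -> [/\ a 0%N 0%N = 0, a 1%N 0%N = 0 & a 0%N 1%N = 0].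
Proof. by move=> o; split; apply: o. Qed.

Lemma tangent_X a : order_ge 2 (a - fpsY) -> tangent_to_id (fpsX, a).
Proof. by move=> o; split; rewrite //= subrr. Qed.

Lemma tangent_Y a : order_ge 2 (a - fpsX) -> tangent_to_id (a, fpsY).
Proof. by move=> o; split; rewrite //= subrr. Qed.

Lemma inverse_X a : order_ge 2 (a - fpsY) ->
  exists b, [/\ order_ge 2 (b - fpsY), fps_comp a (fpsX, b) = fpsY,
    fps_comp b (fpsX, a) = fpsY & summable a -> summable b].
Proof.
move=> o; have ta := tangent_X o.
have [[p b] [tb e1 e2 c]] := tangent_inverse ta.
have fb := tangent_fixes tb; have fa := tangent_fixes ta.
have ep : p = fpsX.
  by rewrite -[LHS](fps_compX fb); have /(congr1 fst) := e1.
rewrite ep in tb e1; case: tb => _ ob.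
exists b; split; [exact: ob|exact: (congr1 snd e1)|exact: (congr1 snd e2)|].
by move=> ca; case: (c (summableX K) ca).
Qed.

(** In the coordinate w = y + f the first component of the field becomes w. Along
    the curve w = 0 the equation (y + f) H_x + g H_y = 0 reduces to g H_y = 0.
    Since the linear part of the field is y d/dx, the integral H has H_x(0) = 0,
    hence H_y(0) <> 0, so that g vanishes on this curve and is divisible by w. The
    quotient is summable because division by a coordinate preserves summability. *)
Lemma divide_by_xdot f g H :
    order_ge 2 f -> order_ge 2 g -> summable f -> summable g ->
    nonsingular_formal_integral (fpsY + f, g) H ->
  exists h, [/\ h 0%N 0%N = 0, summable h &
    analytically_conjugate (fpsY + f, g) (fpsY, fpsY * h)].
Proof.
move=> of_ og cf cg [dH vH].
have oF : order_ge 2 (fpsY + f - fpsY) by rewrite addrAC subrr add0r.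
have [q [oq Fq qF cq]] := inverse_X oF.
have cF : summable (fpsY + f) by apply: summableD => //; apply: summableY.
have {}cq := cq cF.
have fp := tangent_fixes (tangent_X oF); have fq := tangent_fixes (tangent_X oq).
set phi := (fpsX, fpsY + f) in fp *; set psi := (fpsX, q) in fq Fq *.
have [f00 f10 f01] := order_ge_lin of_; have [g00 g10 g01] := order_ge_lin og.
(* The coefficient of y in (y + f) H_x + g H_y is H_x(0). *)
have Hy0 : fps_dy H 0%N 0%N != 0.
  apply/eqP => Hy; apply: dH; rewrite Hy; congr pair.
  move/fps2P: vH => /(_ 0%N 1%N); rewrite /lie_derivative fpsD !fpsM /=.
  rewrite !big_ord1 !big_ord_recl !big_ord0 /= /bump /=.
  by rewrite f00 f01 g00 g01 !(addr0, add0r, mul0r, mul1r) => ->.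
have psiphi : Defs.map_comp psi phi = (fpsX, fpsY).
  by rewrite /Defs.map_comp fps_compX // qF.
have back a : fps_comp (fps_comp a psi) phi = a.
  by rewrite fps_compA // psiphi fps_comp_id.
set m := divY (fps_comp g psi).
have gm : fps_comp g psi = fpsY * m.
  suff r0 : resY (fps_comp g psi) = 0 by rewrite {1}[LHS]divYE r0 add0r.
  apply: (@unit_cancel _ (resY (fps_comp (fps_dy H) psi))); last first.
    by rewrite /= fps_comp00.
  rewrite -resYM -fps_compM //.
  have -> : g * fps_dy H = - ((fpsY + f) * fps_dx H).
    by apply/eqP; rewrite -addr_eq0 addrC; apply/eqP.
  by rewrite fps_compN fps_compM // Fq -mulrN resY_mulY.
pose h := fps_comp (fps_dx f) psi + m * (1 + fps_comp (fps_dy f) psi).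
have lieF : lie_derivative (fpsY + f, g) (fpsY + f) = fps_comp (fpsY * h) phi.
  rewrite -[LHS]back; congr fps_comp.
  rewrite /lie_derivative dxD dyD dxY dyY add0r fps_compD !fps_compM //.
  by rewrite fps_compD fps_comp1 // Fq gm /h [RHS]mulrDr [in RHS]mulrA.
have cm : summable m by apply: summable_divY; apply: summable_comp => //; apply: summableX.
exists h; split.
- rewrite /h fpsD fps_comp00 //.
  have -> : fps_dx f 0%N 0%N = 0 by rewrite /= f10 mul0rn.
  rewrite add0r fpsM !big_ord1.
  have -> : m 0%N 0%N = (fpsY * m) 0%N 1%N by rewrite mul_fpsY.
  by rewrite -gm (fps_comp_order fq og) // mul0r.
- apply: summableD; first by apply: summable_comp => //; [apply: summable_dx|apply: summableX].
  apply: summableM => //; apply: summableD; first exact: summable1.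
  by apply: summable_comp => //; [apply: summable_dy|apply: summableX].
exists phi; split.
- exact: tangent_X.
- exact: summableX.
- exact: cF.
by split; [rewrite lieX fps_compY|].
Qed.

(** The field y (d/dx + h d/dy) is tangent to the orbits of the regular field
    d/dx + h d/dy. If F(x, y0) is the solution through (0, y0) of the latter, the
    inverse (x, G) of (x, F) has a first integral G as second component, and in
    these coordinates the speed y of x becomes F. *)
Lemma straighten_foliation h : h 0%N 0%N = 0 -> summable h ->
  exists F, [/\ order_ge 2 (F - fpsY), summable F &
    analytically_conjugate (fpsY, fpsY * h) (F, 0)].
Proof.
move=> h0 ch; have [S [S0 eS cS]] := flow_exists h0 ch.
pose F := fpsY + fpsX * S.
have oF : order_ge 2 (F - fpsY).
  by rewrite addrAC subrr add0r; apply/mulX_order/order_ge1.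
have cF : summable F.
  by apply: summableD; [apply: summableY|apply: summableM => //; apply: summableX].
have [G [oG FG GF cG]] := inverse_X oF.
have fF := tangent_fixes (tangent_X oF); have fG := tangent_fixes (tangent_X oG).
have Fx : fps_dx F = fps_comp h (fpsX, F) by rewrite dxD dxY add0r eS dx_prim.
exists F; split=> //; exists (fpsX, G); split.
- exact: tangent_X.
- exact: summableX.
- exact: cG.
split; first by rewrite lieX FG.
rewrite fps_comp0 /lie_derivative -mulrA -mulrDr.
suff -> : fps_dx G + h * fps_dy G = 0 by rewrite mulr0.
(* Differentiate G(x, F(x, y)) = y with respect to x. *)
have H : fps_comp (fps_dx G + h * fps_dy G) (fpsX, F) = 0.
  have := dxY; rewrite -GF -lie_dx lie_comp // !lie_dx dxX Fx mulr1 => <-.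
  by rewrite fps_compD fps_compM // [fps_comp h _ * _]mulrC.
have id2 : Defs.map_comp (fpsX, F) (fpsX, G) = (fpsX, fpsY).
  by rewrite /Defs.map_comp fps_compX // FG.
by rewrite -[LHS]fps_comp_id -id2 -(fps_compA _ fF fG) H fps_comp0.
Qed.

End Steps.

(** * Normalization along the fibres *)

Section Normalize.
Variable K : numFieldType.
Implicit Types (a b c f g h F H S : fps2 K) (phi psi v w : fps2 K * fps2 K).

Lemma fixes_shift b : b 0%N 0%N = 0 -> fixes_origin (fpsX + b, fpsY).
Proof. by move=> b0; split; rewrite // fpsD b0 addr0. Qed.

Lemma resY_dx a : resY (fps_dx a) = fps_dx (resY a).
Proof. by apply/fps2P => i j /=; case: eqP => // _; rewrite mul0rn. Qed.

(** The second order Taylor formula a(x + b) = a + b (a' + b R(x, b)), with one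
    remainder R for all increments b: divide a(x + y) twice by y. *)
Lemma taylor_in_x r : exists R : fps2 K,
  (summable (fps_in_x r) -> summable R) /\
  forall b, b 0%N 0%N = 0 -> fps_comp (fps_in_x r) (fpsX + b, fpsY) =
    fps_in_x r + b * (fps_dx (fps_in_x r) + b * fps_comp R (fpsX, b)).
Proof.
set a := fps_in_x r.
have fs : @fixes_origin K (fpsX + fpsY, fpsY) by apply: fixes_shift.
have resa : resY a = a by apply/fps2P => i j /=; case: ifP.
have f0 : @fixes_origin K (fpsX, 0) by [].
pose Z := fps_comp a (fpsX + fpsY, fpsY).
have res_shift (e : fps2 K) : resY (fps_comp e (fpsX + fpsY, fpsY)) = resY e.
  rewrite !resY_comp (fps_compA _ fs f0) /Defs.map_comp fps_compD.
  by rewrite (fps_compX f0) (fps_compY f0) addr0.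
have dZ : resY (divY Z) = fps_dx a.
  transitivity (resY (fps_dy Z)); first by apply/fps2P => i j /=; rewrite mulr1n.
  rewrite -lie_dy lie_comp // !lie_dy dyD dyX dyY add0r mulr1 dy_in_x.
  by rewrite fps_comp0 mul0r addr0 res_shift resY_dx resa.
exists (divY (divY Z)); split=> [ca|b b0].
  do 2 apply: summable_divY; apply: summable_comp => //; last exact: summableY.
  by apply: summableD; [exact: summableX|exact: summableY].
have fb := fixesXY b0.
have fsb := fixes_shift b0.
have fsb' : fixes_origin (fpsX + b, b) by split; [exact: fsb.1|].
have in_x_comp c : resY c = c -> fps_comp c (fpsX, b) = c.
  move=> cE; rewrite -[in RHS](fps_comp_id c) -cE.
  by apply: (@fps_in_x_comp _ _ (fpsX, b)).
have -> : fps_comp a (fpsX + b, fpsY) = fps_comp Z (fpsX, b).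
  rewrite (fps_compA _ fs fb) /Defs.map_comp fps_compD (fps_compX fb) (fps_compY fb).
  exact: (@fps_in_x_comp _ _ (fpsX + b, fpsY) _ fsb fsb').
have dxa : resY (fps_dx a) = fps_dx a by rewrite resY_dx resa.
rewrite {1}[Z]divYE [divY Z in LHS]divYE dZ res_shift resa.
rewrite !(fps_compD, fps_compM fb) (fps_compY fb).
by rewrite (in_x_comp _ resa) (in_x_comp _ dxa).
Qed.

(** The algebra behind [fibre_coordinate], in which Sx is the differential equation
    for S. After D and z1 are expanded by Taylor's formula and dz is eliminated by
    the derivative of y - z = F V, the terms without Sx on the two sides differ by a
    multiple of F^2, which the remaining term F^2 D Sx matches. *)
Lemma fibre_identity (A : comPzRingType) (y F S Sx Fx z dz z1 V Vx d k D d1 C R : A) :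
    y - z = F * V -> V = d + F * k -> - dz = Fx * V + F * Vx ->
    D = d + F * S * d1 -> z1 = z + F * S * (dz + F * S * R) -> C * D = 1 ->
    Sx = C * ((1 + Fx * S) * (k - S * d1) + S * Vx - S * S * R) ->
  F * (D * (1 + (Fx * S + F * Sx))) = y - z1.
Proof.
move=> /eqP; rewrite subr_eq => /eqP -> Vd dzE DE -> CD ->.
have -> : dz = - (Fx * V + F * Vx) by rewrite -dzE opprK.
set Q := (_ + _ - _).
have -> : F * (D * (1 + (Fx * S + F * (C * Q)))) =
   F * (D * (1 + Fx * S)) + F * F * (C * D) * Q by ring.
by rewrite CD DE /Q Vd; ring.
Qed.

(** X0 is the primitive of d and r = z o X0^-1. The first component of the inverse
    of (X0, y) could a priori depend on y; that r is independent of y follows by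
    differentiating r o (X0, y) = z with respect to y. *)
Lemma reparametrize (z d : nat -> K) :
    (forall i, (i < 2)%N -> z i = 0) -> d 0%N = 1 -> summable (fps_in_x d) ->
  exists X0 (r : nat -> K), [/\ tangent_to_id (X0, fpsY), summable X0,
    fps_dx X0 = fps_in_x d, forall i, (i < 2)%N -> r i = 0 &
    fps_comp (fps_in_x r) (X0, fpsY) = fps_in_x z].
Proof.
move=> z0 d0 cd; set zeta := fps_in_x z.
have [X0 [EX0 tX0 cX0]] : exists X0,
    [/\ X0 = fpsX * prim_divX (fps_in_x d), tangent_to_id (X0, fpsY) & summable X0].
  exists (fpsX * prim_divX (fps_in_x d)); split=> //; last first.
    by apply: summableM; [apply: summableX|apply: summable_prim].
  apply: tangent_Y; rewrite -[X in _ - X]mulr1 -mulrBr; apply/mulX_order/order_ge1.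
  have -> : (prim_divX (fps_in_x d) - 1) 0%N 0%N = d 0%N / 1%:R - 1 by [].
  by rewrite d0 divr1 subrr.
have dyX0 : fps_dy X0 = 0.
  apply/fps2P => i j; transitivity (X0 i j.+1 *+ j.+1) => //.
  by rewrite EX0 mul_fpsX; case: i => [|i] /=; rewrite ?mul0r mul0rn.
have dxX0 : fps_dx X0 = fps_in_x d by rewrite EX0 dx_prim.
have fX0 := tangent_fixes tX0.
have [chi [tchi X0chi chiX0 _]] := tangent_inverse tX0.
have fchi := tangent_fixes tchi.
(* rho is z o X0^-1 as a series in two variables. *)
have [rho Erho] : exists rho, rho = fps_comp zeta chi by eexists.
have rhoX0 : fps_comp rho (X0, fpsY) = zeta.
  by rewrite Erho (fps_compA _ fchi fX0) chiX0 fps_comp_id.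
have dyrho : fps_dy rho = 0.
  have H : fps_comp (fps_dy rho) (X0, fpsY) = 0.
    have : lie_derivative (0, 1) (fps_comp rho (X0, fpsY)) = 0.
      by rewrite lie_dy rhoX0; exact: dy_in_x.
    by rewrite (lie_comp _ _ fX0) !lie_dy dyX0 dyY mulr0 add0r mulr1.
  by rewrite -[LHS]fps_comp_id -X0chi -(fps_compA _ fX0 fchi) H fps_comp0.
have rhoE : fps_in_x (fun i => rho i 0%N) = rho.
  apply/fps2P => i [|j] //=.
  have /fps2P/(_ i j) /eqP := dyrho.
  by rewrite [_ i j]/= fps0 -mulr_natr mulf_eq0 pnatr_eq0 orbF => /eqP ->.
have ozeta : order_ge 2 zeta.
  by move=> i [|j] //= lt; apply: z0; rewrite addn0 in lt.
exists X0, (fun i => rho i 0%N).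
split; [exact: tX0|exact: cX0|exact: dxX0| |by rewrite rhoE].
by move=> i lt; rewrite Erho (fps_comp_order fchi ozeta) // addn0.
Qed.

(** F d/dx is a family, with parameter y, of vector fields on a line. Its zeros form
    the curve y = z(x), and d = 1 / F_y along this curve. The coordinate p = x + F S
    fixes the curve pointwise, and by the choice of d the equation to be solved,
    F d(p) p_x = y - z(p), holds modulo F^2 whatever S is. Dividing it by F^2 leaves
    a regular differential equation for S.

    With G the inverse of F in the variable y, restricting to w = 0 the expansion
    G(x, w) = z(x) + w (d(x) + w k0(x, w)) and substituting w = F gives z, d and the
    factorization y - z = F V, V = d + F k, whose summability is then clear. *)
Lemma fibre_coordinate F : order_ge 2 (F - fpsY) -> summable F ->
  exists (z d : nat -> K) p,
    [/\ forall i, (i < 2)%N -> z i = 0, d 0%N = 1 & summable (fps_in_x d)] /\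
    [/\ order_ge 2 (p - fpsX), summable p &
      F * (fps_comp (fps_in_x d) (p, fpsY) * fps_dx p)
      = fpsY - fps_comp (fps_in_x z) (p, fpsY)].
Proof.
move=> oF cF; have [G [oG FG GF /(_ cF) cG]] := inverse_X oF.
have fF := tangent_fixes (tangent_X oF).
have [F00 _ _] := order_ge_lin oF.
have {}F00 : F 0%N 0%N = 0 by move: F00; rewrite fpsB subr0.
pose zeta := resY G; pose V0 := divY G; pose d := resY V0; pose k0 := divY V0.
pose V := fps_comp V0 (fpsX, F); pose k := fps_comp k0 (fpsX, F).
have in_x_comp c : fps_comp (resY c) (fpsX, F) = resY c.
  rewrite -[RHS]fps_comp_id.
  by apply: (@fps_in_x_comp _ _ (fpsX, F) fpsY).
have eV : fpsY - zeta = F * V.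
  rewrite -GF {1}[G]divYE fps_compD in_x_comp (fps_compM fF) (fps_compY fF).
  by rewrite addrAC subrr add0r.
have ek : V = d + F * k.
  by rewrite /V [V0]divYE fps_compD in_x_comp (fps_compM fF) (fps_compY fF).
have edz : - fps_dx zeta = fps_dx F * V + F * fps_dx V.
  rewrite -dxM -eV dxD dxY add0r.
  by apply/fps2P => i j; rewrite fpsN /= -mulNrn.
have cV0 : summable V0 by apply: summable_divY.
have cd : summable d by apply: summable_resY.
have czeta : summable zeta by apply: summable_resY.
have cV : summable V by apply: summable_comp => //; apply: summableX.
have ck : summable k by apply: summable_comp => //; [apply: summable_divY|apply: summableX].
have d00 : d 0%N 0%N = 1.
  by have [_ _ ] := order_ge_lin oG; rewrite fpsB /= => /eqP; rewrite subr_eq0 => /eqP.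
have [c [dc /(_ cd) cc]] := unit_inverse d00.
have [R [/(_ czeta) cR taylorz]] := taylor_in_x (fun i => G i 0%N).
have [Rd [/(_ cd) cRd taylord]] := taylor_in_x (fun i => V0 i 0%N).
(* C o (x, F S) is 1 / d(x + F S). *)
pose C := fps_comp c (fpsX + fpsY, fpsY).
have fs : @fixes_origin K (fpsX + fpsY, fpsY) by apply: fixes_shift.
have cC : summable C.
  apply: summable_comp => //; last exact: summableY.
  by apply: summableD; [exact: summableX|exact: summableY].
pose d1 S := fps_dx d + F * S * fps_comp Rd (fpsX, F * S).
pose A S := fps_comp C (fpsX, F * S) *
  ((1 + fps_dx F * S) * (k - S * d1 S) + S * fps_dx V - S * S * fps_comp R (fpsX, F * S)).
have tA : tame A.
  have tF := tame_cst cF; have tFx := tame_cst (summable_dx cF); have ti := @tame_id K.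
  have t1 := tame_cst (@summable1 K).
  have tc a : summable a -> tame (fun S => fps_comp a (fpsX, F * S)).
    by move=> ca; apply: (tame_comp ca cF F00 ti).
  have td1 : tame d1.
    by apply: tameD (tame_cst (summable_dx cd)) (tameM (tameM tF ti) (tc _ cRd)).
  apply: tameM (tc _ cC) (tameB (tameD (tameM _ _) _) _).
  - exact: tameD t1 (tameM tFx ti).
  - exact: tameB (tame_cst ck) (tameM ti td1).
  - exact: tameM ti (tame_cst (summable_dx cV)).
  - exact: tameM (tameM ti ti) (tc _ cR).
have [S [S00 Sx cS]] := tame_ode tA.
pose p := fpsX + F * S.
have FS00 : (F * S) 0%N 0%N = 0 by rewrite fpsM !big_ord1 F00 mul0r.
have fFS := fixesXY FS00.
have op : order_ge 2 (p - fpsX).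
  by rewrite /p addrAC subrr add0r; apply: (@order_geM _ 1 1); apply/order_ge1.
have tp := tangent_Y op; have fp := tangent_fixes tp.
have fp' : fixes_origin (p, F * S) by split; [exact: fp.1|].
pose D := fps_comp d (p, fpsY).
have CD : fps_comp C (fpsX, F * S) * D = 1.
  rewrite (fps_compA _ fs fFS) /Defs.map_comp fps_compD (fps_compX fFS) (fps_compY fFS).
  rewrite /D (@fps_in_x_comp _ _ (p, fpsY) (F * S) fp fp') -(fps_compM fp').
  by rewrite [c * d]mulrC dc (fps_comp1 fp').
have key : F * (D * fps_dx p) = fpsY - fps_comp zeta (p, fpsY).
  rewrite /p dxD dxX dxM.
  apply: (fibre_identity eV ek edz _ _ CD Sx).
    by rewrite /D taylord.
  by rewrite taylorz.
exists (fun i => G i 0%N), (fun i => V0 i 0%N), p; split; split=> //.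
  by move=> i lt; have := oG i 0%N; rewrite addn0 fpsB /= andbF subr0; apply.
by apply: summableD; [apply: summableX|apply: summableM].
Qed.

(** For X = X0(p) with X0' = d, the equation of [fibre_coordinate] says that the
    derivative of X along F d/dx is y - z(p) = y - (z o X0^-1)(X). *)
Lemma normalize_fibrewise F : order_ge 2 (F - fpsY) -> summable F ->
  exists r, (forall i, (i < 2)%N -> r i = 0) /\
    analytically_conjugate (F, 0) (fpsY + fps_in_x r, 0).
Proof.
move=> oF cF; have [z [d [p [[z0 d0 cd] [op cp key]]]]] := fibre_coordinate oF cF.
have [X0 [r [tX0 cX0 dX0 r0 rX0]]] := reparametrize z0 d0 cd.
have tp := tangent_Y op; have fp := tangent_fixes tp; have fX0 := tangent_fixes tX0.
exists (fun i => - r i); split; first by move=> i /r0 ->; rewrite oppr0.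
exists (Defs.map_comp (X0, fpsY) (p, fpsY)); split.
- exact: tangent_comp.
- by apply: summable_comp => //; exact: summableY.
- by apply: summable_comp => //; exact: summableY.
have fX0p := comp_fixes fX0 fp.
split; rewrite /= ?fps_comp0 (lie_comp _ _ fp) /=; last first.
  by rewrite dxY dyY fps_comp0 mul0r add0r lieY mulr0.
have -> : fps_in_x (fun i => - r i) = - fps_in_x r.
  by apply/fps2P => i [|j] //; rewrite fpsN /= oppr0.
have -> : fps_comp (fpsY - fps_in_x r) (Defs.map_comp (X0, fpsY) (p, fpsY)) =
    fpsY - fps_comp (fps_in_x z) (p, fpsY).
  rewrite fps_compB (fps_compY fX0p) -(fps_compA (fps_in_x r) fX0 fp) rX0.
  by congr (_ - _); exact: fps_compY fp.
by rewrite lieY mulr0 addr0 dX0 -key /lie_derivative mul0r addr0 mulrCA.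
Qed.

End Normalize.

(** * Summability and convergence on polydiscs *)

Section Convergence.
Variable K : numFieldType.
Implicit Types (a : fps2 K) (rho C : K).

(** The form of completeness that turns bounded sums into convergent series. It
    holds for complex numbers too, where nonnegative elements are real. *)
Definition monotone_complete := forall (u : nat -> K) (M : K),
  (forall n, 0 <= u n) -> (forall m n, (m <= n)%N -> u m <= u n) ->
  (forall n, u n <= M) -> cvgn u.

(** The terms, of total degree n, of the series in [fps_convergent]. *)
Definition degsum a (x y : K) n : K :=
  \sum_(i < n.+1) `|a i (n - i)%N * x ^+ i * y ^+ (n - i)%N|.

Lemma norm_le_degsum rho a C x y m : 0 <= rho -> norm_le rho a C ->
  `|x| <= rho -> `|y| <= rho -> \sum_(n < m) degsum a x y n <= C.
Proof.
move=> r0 A xr yr; apply: le_trans (A m).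
rewrite /degsum (sum_antidiagonals (fun i j => `|a i j * x ^+ i * y ^+ j|)).
apply: ler_sum => i _; apply: ler_sum => j _; case: ifP => _; last first.
  by rewrite mulr_ge0 ?exprn_ge0.
rewrite !normrM -mulrA ler_wpM2l // !normrX exprD.
by apply: ler_pM; rewrite ?exprn_ge0 //; apply: lerXn2r; rewrite ?nnegrE.
Qed.

Lemma nrm_degsum n rho a : 0 <= rho ->
  nrm n rho a <= \sum_(m < n + n) degsum a rho rho m.
Proof.
move=> r0; rewrite /degsum (sum_antidiagonals (fun i j => `|a i j * rho ^+ i * rho ^+ j|)).
have nn : (n <= n + n)%N by rewrite leq_addr.
have g0 i j : 0 <= `|a i j| * rho ^+ (i + j) by rewrite mulr_ge0 ?exprn_ge0.
rewrite /nrm (big_ord_widen _ (fun i => \sum_(j < n) `|a i j| * rho ^+ (i + j)) nn).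
rewrite big_mkcond; apply: ler_sum => i _; case: ltnP => li; last first.
  by apply: sumr_ge0 => j _; case: ifP.
rewrite (big_ord_widen _ (fun j => `|a i j| * rho ^+ (i + j)) nn) big_mkcond.
apply: ler_sum => j _; case: ltnP => lj; last by case: ifP.
rewrite ifT; last lia.
by rewrite -mulrA -exprD normrM [X in _ <= _ * X]ger0_norm ?exprn_ge0.
Qed.

(** A square of side n lies below the antidiagonal 2 n, so bounded sums by degree
    bound the sums over squares. *)
Lemma fps_convergent_summable a : fps_convergent a -> summable a.
Proof.
move=> [rho rho0 H].
have r0 : 0 < rho / 2 by rewrite divr_gt0.
have lt : `|rho / 2| < rho.
  by rewrite ger0_norm ?(ltW r0) // ltr_pdivrMr // mulr_natr mulr2n ltrDl.
have /(@cvg_seq_bounded K K)/pinfty_ex_gt0[M _ uM] := H _ _ lt lt.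
exists (rho / 2) => //; exists M => n.
apply: le_trans (nrm_degsum n a (ltW r0)) _.
have := uM (n + n)%N I; rewrite /= ger0_norm.
  by rewrite /series /= big_mkord.
by rewrite /series /= sumr_ge0 // => i _; apply: sumr_ge0.
Qed.

Lemma cvgn_dist (u : nat -> K) (l : K) :
  (forall e, 0 < e -> exists N, forall n, (N <= n)%N -> `|l - u n| < e) -> cvgn u.
Proof.
move=> H; apply/cvg_ex; exists l; apply/cvgrPdist_lt => e /H[N HN].
by exists N => // n; apply: HN.
Qed.

Lemma summable_fps_convergent a : monotone_complete -> summable a -> fps_convergent a.
Proof.
move=> Kc [rho rho0 [C A]]; exists rho => // x y xr yr.
have E n : series (fun n => degsum a x y n) n = \sum_(m < n) degsum a x y m.
  by rewrite /series /= big_mkord.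
apply: (Kc _ C) => [n|m n le|n].
- by apply: sumr_ge0 => i _; apply: sumr_ge0.
- rewrite [leRHS](big_cat_nat (n := m)) //= lerDl.
  by apply: sumr_ge0 => i _; apply: sumr_ge0.
- rewrite [leLHS]E; apply: norm_le_degsum A _ _; exact: ltW.
Qed.

End Convergence.

Lemma monotone_complete_real (R : realType) : monotone_complete (R : numFieldType).
Proof.
move=> u M u0 um uM; apply: nondecreasing_is_cvgn; first by move=> m n; apply: um.
by exists M => _ [n _ <-].
Qed.

Lemma monotone_complete_complex (R : realType) :
  monotone_complete (R[i] : numFieldType).
Proof.
move=> u M u0 um uM.
have uE n : u n = (complex.Re (u n))%:C%C.
  by have := u0 n; rewrite lecE => /andP[/eqP + _]; case: (u n) => x y /= ->.
have cu : cvgn (fun n => complex.Re (u n)).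
  apply: nondecreasing_is_cvgn => [m n le|].
    by have := um _ _ le; rewrite lecE => /andP[].
  exists (complex.Re M) => _ [n _ <-].
  by have := uM n; rewrite lecE => /andP[].
have /cvg_ex[l /= /cvgrPdist_lt ul] := cu.
apply: (@cvgn_dist _ u l%:C%C) => e e0.
have re0 : 0 < complex.Re e by move: e0; rewrite ltcE => /andP[].
have eE : e = (complex.Re e)%:C%C.
  by move: e0; rewrite ltcE; case: (e) => x y /= /andP[/eqP -> _].
have [N _ HN] := ul _ re0; exists N => n /HN.
by rewrite /= uE eE -rmorphB normc_def /= expr0n addr0 sqrtr_sqr ltcR.
Qed.

Lemma analytically_conjugate_transforms (K : numFieldType) (v w : fps2 K * fps2 K) :
  monotone_complete K -> analytically_conjugate v w ->
  exists2 phi, convergent_transformation phi & transforms phi v w.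
Proof.
move=> Kc [phi [tp c1 c2 [e1 e2]]].
have [psi [ts ps sp _]] := tangent_inverse tp.
have [fp fs] := conj (tangent_fixes tp) (tangent_fixes ts).
exists phi; first by split; [exists psi; split|..]; try exact: summable_fps_convergent.
exists psi; first by split.
rewrite /pushforward /Defs.map_comp /= e1 e2 (fps_compA _ fp fs) (fps_compA _ fp fs) ps.
by rewrite !fps_comp_id -surjective_pairing.
Qed.

Theorem theorem1p1 (R : realType) (K : numFieldType)
    (K_real_or_complex : K = R :> numFieldType \/ K = R[i] :> numFieldType)
    (f g : fps2 K)
    (f_convergent : fps_convergent f) (g_convergent : fps_convergent g)
    (f_order : order_ge 2 f) (g_order : order_ge 2 g)
    (v_integral : exists H : fps2 K,
        nonsingular_formal_integral (fpsY + f, g) H) :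
  exists (phi : fps2 K * fps2 K) (r : nat -> K),
    [/\ convergent_transformation phi,
        forall i : nat, (i < 2)%N -> r i = 0 &
        transforms phi (fpsY + f, g) (fpsY + fps_in_x r, 0)].
Proof.
have Kc : monotone_complete K.
  case: K_real_or_complex => ->.
    exact: monotone_complete_real.
  exact: monotone_complete_complex.
have [H vH] := v_integral.
have [h [h0 ch vh]] := divide_by_xdot f_order g_order
  (fps_convergent_summable f_convergent) (fps_convergent_summable g_convergent) vH.
have [F [oF cF hF]] := straighten_foliation h0 ch.
have [r [r0 Fr]] := normalize_fibrewise oF cF.
have [phi cphi tphi] := analytically_conjugate_transforms Kc
  (analytically_conjugate_trans vh (analytically_conjugate_trans hF Fr)).
by exists phi, r.
Qed.
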